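(* Let $\Lambda$ be a semigroup as in the context. If $(\nu,s)\in A_k$ for some $0\le k\le d$, then the jet space $j_s(H^*_\nu)$ is a locally closed subset of $H_s(Z^\Lambda)_0$, isomorphic to $\{0\}$ if $k=0$, or to $$(\mathbb{C}^* )^k\times\mathbb{A}_{\mathbb{C}}^{ks-\mathrm{ord}_{\mathcal{J}_k}(\nu)}$$ if $k>0$.
   Context: $M$ is a lattice of rank $d$, $N$ its dual lattice. $\Lambda\subset M$ is a finitely generated sub-semigroup (containing $0$) which generates $M$ as a group and such that $\sigma^\vee:=\mathbb{R}_{\ge0}\Lambda\subset M_{\mathbb{R}}$ is a strictly convex cone of dimension $d$; $\sigma\subset N_{\mathbb{R}}$ is the dual cone, $\mathring\sigma$ its interior. $e_1,\dots,e_n$ is the minimal system of generators of $\Lambda$. $Z^\Lambda:=\mathrm{Spec}\,\mathbb{C}[\Lambda]\subset\mathbb{A}^n_{\mathbb{C}}$ via $x_i=X^{e_i}$; $0$ is the origin. $H_s(Z^\Lambda)_0$ is the (reduced) space of $s$-jets $\mathrm{Spec}\,\mathbb{C}[t]/(t^{s+1})\to Z^\Lambda$ with origin $0$, and $j_s$ is the truncation map from arcs to $s$-jets. For $\nu\in\mathring\sigma\cap N$, $H^*_\nu=H^*_{\Lambda,\nu}$ is the set of arcs $h:\mathrm{Spec}\,\mathbb{C}[[t]]\to Z^\Lambda$ such that for every $u\in\Lambda$ the series $X^u\circ h$ is non-zero and $\mathrm{ord}_t(X^u\circ h)=\langle\nu,u\rangle$. For $1\le k\le d$, $\mathcal{J}_k=\{e_{i_1}+\cdots+e_{i_k}\mid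 e_{i_1}\wedge\cdots\wedge e_{i_k}\ne0,\ 1\le i_1<\cdots<i_k\le n\}$, $\mathcal{N}(\mathcal{J}_k)$ is the convex hull of $\mathcal{J}_k+\sigma^\vee$, and $\mathrm{ord}_{\mathcal{J}_k}(\nu)=\inf_{\omega\in\mathcal{N}(\mathcal{J}_k)}\langle\nu,\omega\rangle$ for $\nu\in\sigma$. Set $\phi_0=0$, $\phi_1=\mathrm{ord}_{\mathcal{J}_1}$, $\phi_k=\mathrm{ord}_{\mathcal{J}_k}-\mathrm{ord}_{\mathcal{J}_{k-1}}$ for $2\le k\le d$, and $\phi_{d+1}=+\infty$. For $0\le k\le d$, $$A_k:=\{(\nu,s)\mid\nu\in\mathring\sigma\cap N,\ s\in\mathbb{Z}_{>0},\ \phi_k(\nu)\le s<\phi_{k+1}(\nu)\}.$$ *)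

(* Defs.v *)
From HB Require Import structures.
From mathcomp Require Import all_boot all_order all_algebra.
From mathcomp Require Import all_classical all_reals all_analysis.
From mathcomp Require Import complex.
From mathcomp Require Import -(notations) mpoly.

Set Implicit Arguments.
Unset Strict Implicit.
Unset Printing Implicit Defensive.

Import Order.TTheory GRing.Theory Num.Theory.
Import numFieldNormedType.Exports.

Local Open Scope classical_set_scope.
Local Open Scope ring_scope.

Definition fps (A : comNzRingType) : Type := nat -> A.

Section FpsRing.
Variable A : comNzRingType.

HB.instance Definition _ := GRing.Zmodule.on (fps A).

Definition fps_const (c : A) : fps A := fun i => if i == 0%N then c else 0.

Definition fps_mul (f g : fps A) : fps A :=
  fun i => \sum_(j < i.+1) f j * g (i - j)%N.

Let tr (m : nat) (f : fps A) : {poly A} := \poly_(j < m.+1) f j.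

Let fps_mul_tr m i (f g : fps A) : (i <= m)%N ->
  fps_mul f g i = (tr m f * tr m g)`_i.
Proof.
move=> im; rewrite coefM; apply: eq_bigr => j _; rewrite !coef_poly.
have -> : (j < m.+1)%N by rewrite (leq_trans (ltn_ord j)) // ltnS.
by have -> : (i - j < m.+1)%N by rewrite ltnS (leq_trans (leq_subr _ _)).
Qed.

Let fps_mulC : commutative fps_mul.
Proof.
by move=> f g; apply/funext => i; rewrite !(@fps_mul_tr i) // mulrC.
Qed.

Let fps_mulA : associative fps_mul.
Proof.
move=> f g h; apply/funext => i.
have -> : fps_mul f (fps_mul g h) i = (tr i f * (tr i g * tr i h))`_i.
  rewrite coefM; apply: eq_bigr => j _; rewrite coef_poly ltn_ord.
  by rewrite (@fps_mul_tr i) // leq_subr.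
have -> : fps_mul (fps_mul f g) h i = (tr i f * tr i g * tr i h)`_i.
  rewrite coefM; apply: eq_bigr => j _; rewrite (@fps_mul_tr i) -1?ltnS //.
  by rewrite [(tr i h)`__]coef_poly ltnS leq_subr.
by rewrite mulrA.
Qed.

Let fps_mul1 : left_id (fps_const 1) fps_mul.
Proof.
move=> f; apply/funext => i.
rewrite /fps_mul big_ord_recl /= subn0 mul1r big1 ?addr0 // => j _.
by rewrite /fps_const /= mul0r.
Qed.

Let fps_mulDl : left_distributive fps_mul +%R.
Proof.
move=> f g h; apply/funext => i.
transitivity (\sum_(j < i.+1) (f j * h (i - j)%N + g j * h (i - j)%N)).
  by apply: eq_bigr => j _; rewrite -mulrDl.
exact: big_split.
Qed.

Let fps_const1_neq0 : fps_const 1 != 0.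
Proof.
by apply/eqP => /(congr1 (fun f : fps A => f 0%N)) /eqP; rewrite oner_eq0.
Qed.

HB.instance Definition _ := GRing.Zmodule_isComNzRing.Build (fps A)
  fps_mulA fps_mulC fps_mul1 fps_mulDl fps_const1_neq0.

Let fps_const_zmod : zmod_morphism fps_const.
Proof.
by move=> x y; apply/funext => -[|i] //; exact: (esym (@subrr A 0)).
Qed.

Let fps_const_monoid : monoid_morphism fps_const.
Proof.
split=> // x y; apply/funext => i.
rewrite [RHS]/(fps_mul _ _ i) /fps_mul big_ord_recl /= subn0 big1 ?addr0.
  by rewrite /fps_const; case: i => [|i] //=; rewrite mulr0.
by move=> j _; rewrite {1}/fps_const /= mul0r.
Qed.

HB.instance Definition _ :=
  GRing.isZmodMorphism.Build A (fps A) fps_const fps_const_zmod.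
HB.instance Definition _ :=
  GRing.isMonoidMorphism.Build A (fps A) fps_const fps_const_monoid.

(* [fps_ord f] is the [t]-adic order of [f]; it is only meaningful for
   [f <> 0], and is 0 by convention at [f = 0]. *)
Definition fps_ord (f : fps A) : nat :=
  match pselect (exists i, f i != 0) with
  | left ex => ex_minn ex
  | right _ => 0%N
  end.

End FpsRing.

Notation jet_ring A s := {poly %/ ('X^(s.+1) : {poly A}) }.

Definition fps_trunc (A : comNzRingType) (s : nat) (f : fps A) : jet_ring A s :=
  in_qpoly 'X^(s.+1) (\poly_(j < s.+1) f j).

(* The lattice [M] is ['rV[int]_d], its dual [N] is ['cV[int]_d], and the
   pairing is the matrix product; [M_R] and [N_R] are ['rV[R]_d], ['cV[R]_d]. *)

Section Semigroups.
Variables (R : realType) (d : nat).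
Implicit Types (L : set 'rV[int]_d) (u : 'rV[int]_d) (nu : 'cV[int]_d).

Definition pairing (A : pzRingType) (nu : 'cV[A]_d) (u : 'rV[A]_d) : A :=
  (u *m nu) 0 0.

Definition embM u : 'rV[R]_d := map_mx intr u.
Definition embN nu : 'cV[R]_d := map_mx intr nu.

Definition is_semigroup L : Prop :=
  L 0 /\ forall u v, L u -> L v -> L (u + v).

Definition is_subgroup L : Prop :=
  L 0 /\ forall u v, L u -> L v -> L (u - v).

Definition generated_semigroup (F : set 'rV[int]_d) := smallest is_semigroup F.
Definition generated_subgroup (F : set 'rV[int]_d) := smallest is_subgroup F.

Definition dual_cone L : set 'rV[R]_d :=
  [set w | exists (m : nat) (c : 'I_m -> R) (u : 'I_m -> 'rV[int]_d),
     [/\ forall i, 0 <= c i, forall i, L (u i)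
       & w = \sum_i c i *: embM (u i)]].

Definition cone L : set 'cV[R]_d :=
  [set nu | forall w, dual_cone L w -> 0 <= pairing nu w].

Definition strictly_convex (K : set 'rV[R]_d) : Prop :=
  forall w, K w -> K (- w) -> w = 0.

Definition full_dimensional (K : set 'rV[R]_d) : Prop :=
  exists B : 'M[R]_d, \rank B = d /\ forall i, K (row i B).

Record toric_semigroup L : Prop := ToricSemigroup {
  toric_is_semigroup : is_semigroup L;
  toric_finitely_generated : exists F, finite_set F /\ generated_semigroup F = L;
  toric_generates_lattice : generated_subgroup L = setT;
  toric_strictly_convex : strictly_convex (dual_cone L);
  toric_full_dimensional : full_dimensional (dual_cone L) }.

Section Generators.
Variable n : nat.
Implicit Types e : 'I_n -> 'rV[int]_d.

Definition minimal_generators L e : Prop :=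
  [/\ injective e,
      generated_semigroup (range e) = L
    & forall F, F `<=` range e -> generated_semigroup F = L -> F = range e].

(* [wedge v] is [v_1 /\ ... /\ v_k], where the exterior power of the free module
   ['rV[int]_d] is embedded in its [k]-th tensor power by
   [v_1 /\ ... /\ v_k |-> \sum_s sgn(s) v_(s 1) (x) ... (x) v_(s k)]; the
   coordinate of that tensor at a multi-index [j] is the determinant below. *)
Definition wedge k (v : 'I_k -> 'rV[int]_d) : {ffun {ffun 'I_k -> 'I_d} -> int} :=
  [ffun j : {ffun 'I_k -> 'I_d} => \det (\matrix_(a, b) v a 0 (j b))].

Definition Jset e (k : nat) : set 'rV[int]_d :=
  [set w | exists i : 'I_k -> 'I_n,
     [/\ forall a b : 'I_k, (a < b)%N -> (i a < i b)%N,
         wedge (e \o i) <> 0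
       & w = \sum_a e (i a)]].

Definition newton_polyhedron L e (k : nat) : set 'rV[R]_d :=
  smallest (@convex_set R 'rV[R]_d)
    [set embM u + w | u in Jset e k & w in dual_cone L].

Definition ordJ L e (k : nat) (nu : 'cV[R]_d) : \bar R :=
  ereal_inf [set (pairing nu w)%:E | w in newton_polyhedron L e k].

Definition phi L e (k : nat) (nu : 'cV[R]_d) : \bar R :=
  if k == 0%N then 0%E
  else if k == d.+1 then +oo%E
  else if k == 1%N then ordJ L e 1 nu
  else (ordJ L e k nu - ordJ L e k.-1 nu)%E.

Definition Aset L e (k : nat) : set ('cV[int]_d * nat) :=
  [set p | [/\ interior (cone L) (embN p.1), (0 < p.2)%N,
              (phi L e k (embN p.1) <= p.2%:R%:E)%E
            & (p.2%:R%:E < phi L e k.+1 (embN p.1))%E]].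

End Generators.
End Semigroups.

(* A reduced quasi-affine variety is represented by its set of closed points in
   affine space ['rV[C]_m]; a morphism of such varieties is a map whose
   coordinates are locally quotients of polynomials. *)

Section Varieties.
Variable C : fieldType.

Definition peval m (x : 'rV[C]_m) (p : mpoly m C) : C :=
  meval (fun i => x 0 i) p.

Definition zariski_closed m (Z : set 'rV[C]_m) : Prop :=
  exists I : set (mpoly m C), Z = [set x | forall p, I p -> peval x p = 0].

Definition zariski_open m (U : set 'rV[C]_m) : Prop := zariski_closed (~` U).

Definition locally_closed_in m (X W : set 'rV[C]_m) : Prop :=
  exists U F, [/\ zariski_open U, zariski_closed F & W = X `&` (U `&` F)].

Definition regular_on m (W : set 'rV[C]_m) (f : 'rV[C]_m -> C) : Prop :=
  forall x, W x -> exists U p q,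
    [/\ zariski_open U, U x
      & forall y, W y -> U y -> peval y q != 0 /\ f y = peval y p / peval y q].

Definition morphism_on m l (W : set 'rV[C]_m) (V : set 'rV[C]_l)
    (f : 'rV[C]_m -> 'rV[C]_l) : Prop :=
  (forall x, W x -> V (f x)) /\ forall i, regular_on W (fun x => f x 0 i).

Definition variety_isomorphic m l (W : set 'rV[C]_m) (V : set 'rV[C]_l) : Prop :=
  exists f g, [/\ morphism_on W V f, morphism_on V W g,
                  forall x, W x -> g (f x) = x & forall y, V y -> f (g y) = y].

Definition torus_times_affine k l : set 'rV[C]_(k + l) :=
  [set x | forall i : 'I_k, x 0 (lshift l i) != 0].

End Varieties.

Section ToricJets.
Variables (C : fieldType) (d n : nat) (e : 'I_n -> 'rV[int]_d).

Definition weight (m : multinom n) : 'rV[int]_d := \sum_i e i *+ m i.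

(* The kernel of [C[x_1, ..., x_n] -> C[L], x_i |-> X^(e i)]; the sum is the
   coefficient of [X^u] in the image of [p]. *)
Definition toric_ideal : set (mpoly n C) :=
  [set p | forall u : 'rV[int]_d,
     \sum_(m <- msupp p | weight m == u) mcoeff m p = 0].

(* The morphisms [Spec A -> Spec C[L]] over [C], in the coordinates [x_i]. *)
Definition toric_points (A : comNzRingType) (c : {rmorphism C -> A}) :
    set ('I_n -> A) :=
  [set x | forall p, toric_ideal p -> mmap c x p = 0].

(* Every [u] in [L] is [weight m] for some exponent [m], and then
   [X^u o h = \prod_i h i ^+ m i] for every arc [h]. *)
Definition toric_arcs (nu : 'cV[int]_d) : set ('I_n -> fps C) :=
  [set h | toric_points (@fps_const C : {rmorphism C -> fps C}) h
    /\ forall m : multinom n,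
         \prod_i h i ^+ m i != 0
         /\ (fps_ord (\prod_i h i ^+ m i))%:Z = pairing nu (weight m)].

(* The jets with all their coefficients as coordinates in [A^(n * (s + 1))]. *)
Definition jet_coords s (x : 'I_n -> jet_ring C s) : 'rV[C]_(n * s.+1) :=
  mxvec (\matrix_(i < n, j < s.+1) (x i : {poly C})`_j).

Definition jet_space0 s : set 'rV[C]_(n * s.+1) :=
  [set jet_coords x | x in
    [set x : 'I_n -> jet_ring C s |
      toric_points (qpolyC 'X^(s.+1) : {rmorphism C -> jet_ring C s}) x
      /\ forall i, (x i : {poly C})`_0 = 0]].

Definition arc_trunc s (h : 'I_n -> fps C) : 'rV[C]_(n * s.+1) :=
  jet_coords (fun i => fps_trunc s (h i)).

End ToricJets.

(* Main.v *)
Require Import Defs.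
From mathcomp Require Import all_boot all_order all_algebra.
From mathcomp Require Import all_classical all_reals all_analysis.
From mathcomp Require Import complex.
From mathcomp Require Import -(notations) mpoly.

(** An arc of order [nu] is a homomorphism [h] from the lattice to the group of
    nonzero Laurent series. Since [C] has characteristic zero, a nonzero series is
    determined by its order, its leading coefficient and its logarithmic
    derivative [t f' / f], and these turn products into sums, products and sums.
    Thus [h] amounts to [nu], a character [chi] of the lattice with values in the
    nonzero elements of [C], and an additive map [omega] from the lattice to the
    power series without constant term ([toric_arc_torus], [torus_arc_toric]).

    Write [v i] for the pairing of [nu] with the generator [e i]; it is positive,
    as [nu] is interior. The [i]-th component of the [s]-jet of [h] is 0 if
    [v i > s]; otherwise it sees the value of [chi] at [e i] and the coefficients
    of [omega (e i)] in the degrees from 1 to [s - v i], and these data determine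
    it by a triangular recursion that is polynomial in both directions, except
    for the inversion of the leading coefficient. The jets are therefore
    parametrised by two independent kinds of data.

    - The restriction of [chi] to the lattice spanned by the [e i] with
      [v i <= s]. As every character of this lattice extends to the whole one
      ([lattice_basis]), this gives a torus, of dimension the rank of the lattice.
    - The coefficients of the [omega (e i)] in the degrees from 1 to [s - v i].
      The hypothesis on [(nu, s)] provides a family [b] of [k] independent
      generators of minimal total weight, with [v (b a) <= s] for all [a], that
      spans all the [e i] with [v i <= s] over the rationals. By exchange, only
      the [b a] with [v (b a) <= v i] occur in the expression of such an [e i]
      ([min_basis_adapted]). So the coefficients along [b] determine the others,
      and they are arbitrary; they number [k s] minus the weight of [b].

    The weight of [b] is the minimum of [nu] on the [k]-th Newton polyhedron
    ([ordJ_min_basis]), and the rank of the lattice is [k]. Finally, the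
    parametrisation has a rational left inverse on the open set where the
    coefficients of degree [v i] are nonzero for all [i] with [v i <= s]. This
    makes its image both locally closed and isomorphic to the parameter space
    ([image_of_section]). *)

Set Implicit Arguments.
Unset Strict Implicit.
Unset Printing Implicit Defensive.

Import Order.TTheory GRing.Theory Num.Theory.
Import numFieldNormedType.Exports.

Local Open Scope classical_set_scope.
Local Open Scope ring_scope.

(** * Power series and logarithmic derivatives *)

(** Course-of-values recursion. The coefficients of a series and those of its
    logarithmic derivative determine each other degree by degree, and both
    recursions below are instances of this one. *)
Fixpoint cov_upto (A : Type) (x0 : A) (F : nat -> (nat -> A) -> A) m : nat -> A :=
  if m is m'.+1 then
    fun i => if (i < m')%N then cov_upto x0 F m' i else F m' (cov_upto x0 F m')
  else fun=> x0.

Definition cov (A : Type) (x0 : A) F m : A := cov_upto x0 F m.+1 m.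

Lemma cov_uptoE (A : Type) (x0 : A) F m i :
  (i < m)%N -> cov_upto x0 F m i = cov x0 F i.
Proof.
elim: m => [//|m IH] im /=; rewrite /cov /= ltnn.
case: ltnP => [|mi]; first by move/IH ->; rewrite /cov /= ltnn.
by have -> : i = m by apply/eqP; rewrite eqn_leq mi -ltnS im.
Qed.

Lemma covE (A : Type) (x0 : A) F m :
  (forall g g', (forall i, (i < m)%N -> g i = g' i) -> F m g = F m g') ->
  cov x0 F m = F m (cov x0 F).
Proof.
move=> HF; rewrite {1}/cov /= ltnn; apply: HF => i im.
exact: cov_uptoE.
Qed.

Lemma fps_mulE (A : comNzRingType) (f g : fps A) i :
  (f * g) i = \sum_(j < i.+1) f j * g (i - j)%N.
Proof. by []. Qed.

Section Series.
Variable C : numFieldType.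
Implicit Types (a b : C) (w f g : fps C).

Lemma fps_addE f g i : (f + g) i = f i + g i.
Proof. by []. Qed.

(** The derivation [t d/dt]; unlike [d/dt] it preserves degrees, so that it is
    compatible with truncation without any shift. *)
Definition theta f : fps C := fun m => m%:R * f m.

Lemma thetaM f g : theta (f * g) = theta f * g + f * theta g.
Proof.
apply/funext => m; rewrite fps_addE {1}/theta !fps_mulE.
rewrite mulr_sumr -big_split; apply: eq_bigr => j _ /=.
rewrite /theta -{1}(@subnKC j m) -1?ltnS // natrD mulrDl mulrA; congr (_ + _).
exact: mulrCA.
Qed.

(** Up to its constant term, [w] is the logarithmic derivative
    [t f' / f] of [f]. *)
Definition is_dlog w f :=
  forall m, m.+1%:R * f m.+1 = \sum_(j < m.+1) w j.+1 * f (m - j)%N.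

Definition no_const w : fps C := fun j => if j is _.+1 then w j else 0.

(** This form makes the additivity of logarithmic derivatives a consequence of
    the Leibniz rule. *)
Lemma is_dlogE w f : is_dlog w f <-> theta f = no_const w * f.
Proof.
split=> [H|H m].
  apply/funext => -[|m]; rewrite fps_mulE /theta big_ord_recl /= !mul0r add0r.
    by rewrite big_ord0.
  by rewrite H; apply: eq_bigr.
have /(congr1 (fun h : fps C => h m.+1)) := H.
by rewrite fps_mulE big_ord_recl /= mul0r add0r.
Qed.

Lemma is_dlogM w v f g : is_dlog w f -> is_dlog v g -> is_dlog (w + v) (f * g).
Proof.
rewrite !is_dlogE => Hf Hg.
have -> : no_const (w + v) = no_const w + no_const v.
  by apply/funext => -[|j] //=; exact: esym (addr0 _).
by rewrite thetaM Hf Hg (mulrCA f) -mulrA -mulrDl.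
Qed.

Lemma is_dlog1 : is_dlog 0 1.
Proof.
move=> m; rewrite big1 ?mulr0 // => j _.
exact: mul0r.
Qed.

(** In characteristic zero the equation [theta f = w f] is triangular in the
    coefficients of [f], so that a truncation of [w] and the constant term of [f]
    fix the truncation of [f] at the same degree. *)
Lemma is_dlog_agree w w' f f' l : is_dlog w f -> is_dlog w' f' ->
  f 0%N = f' 0%N -> (forall j, (j < l)%N -> w j.+1 = w' j.+1) ->
  forall m, (m <= l)%N -> f m = f' m.
Proof.
move=> H H' f0 ww; elim/ltn_ind => -[|m] IH ml //.
apply: (@mulfI _ m.+1%:R); first by rewrite pnatr_eq0.
rewrite H H'; apply: eq_bigr => j _.
rewrite ww ?IH // ?ltnS ?leq_subr //; last exact: leq_trans ml.
by rewrite (leq_trans _ (ltnW ml)) // leq_subr.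
Qed.

(** Conversely, if [f] has an invertible constant term, the same equation is
    triangular in the coefficients of [w]. *)
Lemma is_dlog_inj w w' f f' l : is_dlog w f -> is_dlog w' f' ->
  f 0%N != 0 -> (forall m, (m <= l)%N -> f m = f' m) ->
  forall j, (j < l)%N -> w j.+1 = w' j.+1.
Proof.
move=> H H' f0 ff; elim/ltn_ind => j IH jl; apply: (mulIf f0).
have := H j; rewrite ff // (H' j) !big_ord_recr /= subnn (ff 0%N) //.
rewrite (eq_bigr (fun i : 'I_j => w i.+1 * f (j - i)%N)); first by move/addrI.
move=> i _; rewrite IH ?ff // ?(ltn_trans (ltn_ord i) jl) //.
by rewrite (leq_trans _ (ltnW jl)) // leq_subr.
Qed.

(** The series with constant term [a] and logarithmic derivative [w]; it is
    [a * exp (\int w / t)]. *)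
Definition expser a w : fps C :=
  cov 0 (fun m E => if m is m'.+1 then
    m%:R^-1 * \sum_(j < m) w j.+1 * E (m' - j)%N else a).

Lemma expser0 a w : expser a w 0%N = a.
Proof. by []. Qed.

Lemma expserS a w m :
  expser a w m.+1 = m.+1%:R^-1 * \sum_(j < m.+1) w j.+1 * expser a w (m - j)%N.
Proof.
rewrite {1}/expser covE // => g g' gg; congr (_ * _); apply: eq_bigr => j _.
by rewrite gg // ltnS leq_subr.
Qed.

Lemma expser_dlog a w : is_dlog w (expser a w).
Proof. by move=> m; rewrite expserS mulrA mulfV ?mul1r // pnatr_eq0. Qed.

Lemma expser_agree a w w' l : (forall j, (j < l)%N -> w j.+1 = w' j.+1) ->
  forall m, (m <= l)%N -> expser a w m = expser a w' m.
Proof. by apply: is_dlog_agree; rewrite ?expser0 //; apply: expser_dlog. Qed.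

Lemma expser_unique a w f : is_dlog w f -> f 0%N = a -> f = expser a w.
Proof.
move=> H f0; apply/funext => m.
exact: (is_dlog_agree H (expser_dlog a w) f0 (fun j _ => erefl _) (leqnn m)).
Qed.

Lemma expserM a b w v : expser a w * expser b v = expser (a * b) (w + v).
Proof.
apply: expser_unique; first exact: (is_dlogM (expser_dlog a w) (expser_dlog b v)).
by rewrite fps_mulE big_ord_recl big_ord0 addr0 subnn.
Qed.

Lemma expser1 : 1 = expser 1 0.
Proof. exact: (expser_unique is_dlog1). Qed.

Definition dlog f : fps C :=
  cov 0 (fun m W => if m is m'.+1 then
    (m%:R * f m - \sum_(j < m') W j.+1 * f (m' - j)%N) / f 0%N else 0).

Lemma dlogS f m : dlog f m.+1 =
  (m.+1%:R * f m.+1 - \sum_(j < m) dlog f j.+1 * f (m - j)%N) / f 0%N.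
Proof.
rewrite {1}/dlog covE // => g g' gg; congr ((_ - _) / _); apply: eq_bigr => j _.
by rewrite gg // ltnS.
Qed.

Lemma dlogP f : f 0%N != 0 -> is_dlog (dlog f) f.
Proof. by move=> f0 m; rewrite big_ord_recr /= subnn dlogS divfK // addrC subrK. Qed.

Definition shift1 f : fps C := fun i => if i is i'.+1 then f i' else 0.
(** The product of [f] with the [v]-th power of [t]. *)
Definition shift v f : fps C := iter v shift1 f.

Lemma shiftE v f l : shift v f l = if (l < v)%N then 0 else f (l - v)%N.
Proof. by elim: v l => [|v IH] [|l] //=; rewrite ?subn0 // IH ltnS subSS. Qed.

Lemma shift1M f g : shift1 f * g = shift1 (f * g).
Proof.
by apply/funext => -[|i]; rewrite fps_mulE big_ord_recl /= mul0r add0r ?big_ord0.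
Qed.

Lemma shiftM v v' f g : shift v f * shift v' g = shift (v + v') (f * g).
Proof.
elim: v => [|v IH] /=; last by rewrite shift1M IH.
elim: v' => [|v' IH] //=.
by rewrite mulrC shift1M mulrC IH.
Qed.

Lemma shift_ord v f : f 0%N != 0 -> shift v f != 0 /\ fps_ord (shift v f) = v.
Proof.
move=> f0; have fv : shift v f v != 0 by rewrite shiftE ltnn subnn.
split; first by apply: contraNneq fv => ->.
rewrite /fps_ord; case: pselect => [ex|[]]; last by exists v.
case: ex_minnP => m fm /(_ v fv) mv.
apply/eqP; rewrite eqn_leq mv leqNgt; apply: contra fm => mv'.
by rewrite shiftE mv'.
Qed.

Lemma ord_shift f : f != 0 ->
  f (fps_ord f) != 0 /\ f = shift (fps_ord f) (fun l => f (fps_ord f + l)%N).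
Proof.
move=> f0; rewrite /fps_ord; case: pselect => [ex|nex]; last first.
  case/eqP: f0; apply/funext => i; apply/eqP; apply/negPn/negP => fi.
  by apply: nex; exists i.
case: ex_minnP => v fv vmin; split=> //; apply/funext => l; rewrite shiftE.
case: ltnP => [lv|vl]; last by rewrite subnKC.
by apply/eqP; apply: contraTT lv => /vmin; rewrite -leqNgt.
Qed.

(** For [a] nonzero, this is the series of order [v] with leading coefficient [a]
    and logarithmic derivative [v + w], where the constant term of [w] is
    ignored. Multiplication acts separately on the three of them. *)
Definition polar v a w : fps C := shift v (expser a w).

Lemma polarM v v' a b w w' :
  polar v a w * polar v' b w' = polar (v + v') (a * b) (w + w').
Proof. by rewrite /polar shiftM expserM. Qed.

Lemma polarX v a w m : polar v a w ^+ m = polar (v * m) (a ^+ m) (w *+ m).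
Proof.
elim: m => [|m IH]; first by rewrite muln0 mulr0n !expr0 /polar /= -expser1.
by rewrite exprS IH polarM mulnS exprS mulrS.
Qed.

Lemma polar_prod n (v : 'I_n -> nat) (a : 'I_n -> C) (w : 'I_n -> fps C) :
  \prod_i polar (v i) (a i) (w i) =
  polar (\sum_i v i) (\prod_i a i) (\sum_i w i).
Proof.
elim: n v a w => [|n IH] v a w.
  by rewrite !big_ord0 /polar /= -expser1.
by rewrite !big_ord_recl IH polarM.
Qed.

Lemma polar_inj v a b w w' : a != 0 -> polar v a w = polar v b w' ->
  a = b /\ forall j, w j.+1 = w' j.+1.
Proof.
move=> a0 H.
have E m : expser a w m = expser b w' m.
  have /(congr1 (fun h : fps C => h (v + m)%N)) := H.
  by rewrite /polar !shiftE ltnNge leq_addr /= addKn.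
split=> [|j]; first exact: (E 0%N).
exact: (is_dlog_inj (expser_dlog a w) (expser_dlog b w') _ (fun m _ => E m)
  (ltnSn j)).
Qed.

Lemma polarP f : f != 0 ->
  exists w, f = polar (fps_ord f) (f (fps_ord f)) w.
Proof.
move=> /ord_shift[f0 fE]; exists (dlog (fun l => f (fps_ord f + l)%N)).
rewrite {1}fE /polar; congr (shift _ _); apply: expser_unique; last by rewrite addn0.
by apply: dlogP; rewrite addn0.
Qed.

Lemma polar_ord v a w : a != 0 ->
  polar v a w != 0 /\ fps_ord (polar v a w) = v.
Proof. by move=> a0; apply: shift_ord. Qed.

End Series.

(** * Rational maps on subsets of affine space *)

Section RationalFunctions.
Variables (C : fieldType) (N : nat) (U : set 'rV[C]_N).
Implicit Types (f g : 'rV[C]_N -> C).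

(** A single quotient of polynomials is required on the whole of [U]. This is
    stronger than regularity, holds for all the maps of the proof, and is closed
    under the ring operations by common denominators. *)
Definition rational_on f := exists p q : mpoly N C,
  forall x, U x -> peval x q != 0 /\ f x = peval x p / peval x q.

Lemma rational_ext f g : (forall x, U x -> f x = g x) ->
  rational_on f -> rational_on g.
Proof.
move=> fg [p [q H]]; exists p, q => x Ux.
by have [q0 <-] := H x Ux; rewrite fg.
Qed.

Lemma rational_cst c : rational_on (fun=> c).
Proof.
exists (mpolyC N c), 1 => x _; rewrite /peval mevalC meval1.
by rewrite oner_eq0 divr1.
Qed.

Lemma rational_coord i : rational_on (fun x => x 0 i).
Proof.
exists (mpolyX C (mnm1 i)), 1 => x _; rewrite /peval mevalXU meval1.
by rewrite oner_eq0 divr1.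
Qed.

Lemma rationalD f g : rational_on f -> rational_on g ->
  rational_on (fun x => f x + g x).
Proof.
move=> [p [q H]] [p' [q' H']]; exists (p * q' + p' * q), (q * q') => x Ux.
have [q0 ->] := H x Ux; have [q0' ->] := H' x Ux.
rewrite /peval mevalD !mevalM -!/(peval _ _) mulf_neq0 //.
by rewrite addf_div.
Qed.

Lemma rationalM f g : rational_on f -> rational_on g ->
  rational_on (fun x => f x * g x).
Proof.
move=> [p [q H]] [p' [q' H']]; exists (p * p'), (q * q') => x Ux.
have [q0 ->] := H x Ux; have [q0' ->] := H' x Ux.
by rewrite /peval !mevalM -!/(peval _ _) mulf_neq0 // mulf_div.
Qed.

Lemma rationalV f : (forall x, U x -> f x != 0) -> rational_on f ->
  rational_on (fun x => (f x)^-1).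
Proof.
move=> f0 [p [q H]]; exists q, p => x Ux.
have := f0 x Ux; have [q0 ->] := H x Ux.
by rewrite mulf_eq0 negb_or invf_div => /andP[].
Qed.

Lemma rationalB f g : rational_on f -> rational_on g ->
  rational_on (fun x => f x - g x).
Proof.
move=> Hf Hg; apply: rationalD => //.
apply: (rational_ext (f := fun x => -1 * g x)) => [x _|]; first by rewrite mulN1r.
by apply: rationalM => //; apply: rational_cst.
Qed.

Lemma rational_sum (I : Type) (r : seq I) (P : pred I) (F : I -> 'rV[C]_N -> C) :
  (forall i, P i -> rational_on (F i)) ->
  rational_on (fun x => \sum_(i <- r | P i) F i x).
Proof.
move=> H; elim: r => [|i r IH].
  by apply: rational_ext (rational_cst 0) => x _; rewrite big_nil.
case Pi: (P i); last by apply: rational_ext IH => x _; rewrite big_cons Pi.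
by apply: rational_ext (rationalD (H i Pi) IH) => x _; rewrite big_cons Pi.
Qed.

Lemma rational_prod (I : Type) (r : seq I) (P : pred I) (F : I -> 'rV[C]_N -> C) :
  (forall i, P i -> rational_on (F i)) ->
  rational_on (fun x => \prod_(i <- r | P i) F i x).
Proof.
move=> H; elim: r => [|i r IH].
  by apply: rational_ext (rational_cst 1) => x _; rewrite big_nil.
case Pi: (P i); last by apply: rational_ext IH => x _; rewrite big_cons Pi.
by apply: rational_ext (rationalM (H i Pi) IH) => x _; rewrite big_cons Pi.
Qed.

Lemma rationalX f n : rational_on f -> rational_on (fun x => f x ^+ n).
Proof.
move=> Hf; apply: rational_ext (rational_prod (F := fun _ : 'I_n => f)
  (index_enum _) (P := predT) (fun _ _ => Hf)).
by move=> x _; rewrite prodr_const card_ord.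
Qed.

Lemma rationalXz f (n : int) : (forall x, U x -> f x != 0) -> rational_on f ->
  rational_on (fun x => f x ^ n).
Proof.
move=> f0 Hf; case: n => n; first exact: rationalX.
apply: rational_ext (rationalV _ (rationalX n.+1 Hf)) => [//|x Ux].
by rewrite expf_neq0 ?f0.
Qed.

Lemma rational_regular (W : set 'rV[C]_N) f :
  W `<=` U -> rational_on f -> regular_on W f.
Proof.
move=> WU [p [q H]] x Wx; exists setT, p, q; split=> //.
  exists [set 1]; rewrite setCT; apply/seteqP; split=> [y []|y /(_ 1 erefl)].
  by rewrite /peval meval1 => /eqP; rewrite oner_eq0.
by move=> y /WU/H.
Qed.

End RationalFunctions.

(** The value of a polynomial at rational functions is built from them by sums
    and products. *)
Lemma rational_comp (C : fieldType) N M (U : set 'rV[C]_N) (V : set 'rV[C]_M)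
    (g : 'rV[C]_N -> 'rV[C]_M) f :
  (forall x, U x -> V (g x)) -> (forall i, rational_on U (fun x => g x 0 i)) ->
  rational_on V f -> rational_on U (fun x => f (g x)).
Proof.
move=> UV Hg [p [q H]].
have Hpol r : rational_on U (fun x => peval (g x) r).
  apply: (@rational_ext _ _ _ (fun x =>
    \sum_(m <- msupp r) mcoeff m r * \prod_i (g x 0 i) ^+ m i)).
    by move=> x _; rewrite /peval mevalE.
  apply: rational_sum => m _; apply: rationalM; first exact: rational_cst.
  by apply: rational_prod => i _; apply: rationalX.
apply: rational_ext (rationalM (Hpol p) (rationalV _ (Hpol q))) => x Ux.
  by have [_ ->] := H _ (UV x Ux).
by have [] := H _ (UV x Ux).
Qed.

(** A section [f] of a rational map [g] is an isomorphism onto its image, and this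
    image is locally closed: in the domain [U] of [g], it is the set of the [x]
    such that [f (g x) = x], which is defined by polynomials once the denominators
    of the coordinates of [f \o g] are cleared. *)
Lemma image_of_section (C : fieldType) N M (q : mpoly N C) (V : set 'rV[C]_M)
    (f : 'rV[C]_M -> 'rV[C]_N) (g : 'rV[C]_N -> 'rV[C]_M) :
  let U := [set x | peval x q != 0] in
  (forall v, V v -> U (f v)) -> (forall x, U x -> V (g x)) ->
  (forall v, V v -> g (f v) = v) ->
  (forall i, rational_on V (fun v => f v 0 i)) ->
  (forall i, rational_on U (fun x => g x 0 i)) ->
  [/\ zariski_open U,
      exists2 F, zariski_closed F & f @` V = U `&` F
    & variety_isomorphic (f @` V) V].
Proof.
move=> U VU UV fK Hf Hg; split.
- exists [set q]; apply/seteqP; split=> x /=.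
    by move/negP/negPn/eqP => qx p ->.
  by move=> /(_ q erefl) qx; rewrite /U /= qx eqxx.
- have H i : rational_on U (fun x => f (g x) 0 i) by apply: rational_comp Hg (Hf i).
  have /choice[pq Hpq] : forall i, exists pq : mpoly N C * mpoly N C,
      forall x, U x -> peval x pq.2 != 0 /\
        f (g x) 0 i = peval x pq.1 / peval x pq.2.
    by move=> i; have [p [q' Hp]] := H i; exists (p, q').
  pose P i := (pq i).1 - mpolyX C (mnm1 i) * (pq i).2.
  exists [set x | forall p, range P p -> peval x p = 0]; first by exists (range P).
  have HP x i : U x -> (peval x (P i) = 0) <-> f (g x) 0 i = x 0 i.
    move=> Ux; have [q0 ->] := Hpq i x Ux.
    rewrite /P /peval mevalB mevalM mevalXU -!/(peval _ _); split.
      by move/eqP; rewrite subr_eq0 => /eqP ->; rewrite mulfK.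
    by move=> <-; rewrite divfK // subrr.
  apply/seteqP; split=> [_ [v Vv <-]|x [Ux Hx]].
    split; first exact: VU.
    by move=> _ [i _ <-]; apply/HP; [exact: VU | rewrite fK].
  exists (g x); first exact: UV.
  by apply/rowP => i; apply/HP => //; apply: Hx; exists i.
- exists g, f; split.
  + split=> [_ [v Vv <-]|i]; first by rewrite fK.
    by apply: rational_regular (Hg i) => _ [v Vv <-]; apply: VU.
  + split=> [v Vv|i]; first by exists v.
    exact: rational_regular (Hf i).
  + by move=> _ [v Vv <-]; rewrite fK.
  + by move=> v Vv; rewrite fK.
Qed.

Section RationalSeries.
Variables (C : numFieldType) (N : nat) (U : set 'rV[C]_N).

Lemma rational_expser (a : 'rV[C]_N -> C) (w : 'rV[C]_N -> fps C) l :
  rational_on U a -> (forall j, (j < l)%N -> rational_on U (fun x => w x j.+1)) ->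
  forall m, (m <= l)%N -> rational_on U (fun x => expser (a x) (w x) m).
Proof.
move=> Ha Hw; elim/ltn_ind => -[|m] IH ml //.
apply: rational_ext (fun x _ => esym (expserS (a x) (w x) m)) _.
apply: rationalM; first exact: rational_cst.
apply: rational_sum => j _; apply: rationalM.
  by apply: Hw; apply: leq_trans ml; apply: ltn_ord.
by apply: IH; rewrite ?ltnS ?leq_subr // (leq_trans (leq_subr _ _)) // ltnW.
Qed.

Lemma rational_dlog (f : 'rV[C]_N -> fps C) l :
  (forall x, U x -> f x 0%N != 0) ->
  (forall j, (j <= l)%N -> rational_on U (fun x => f x j)) ->
  forall m, (m < l)%N -> rational_on U (fun x => dlog (f x) m.+1).
Proof.
move=> f0 Hf; elim/ltn_ind => m IH ml.
apply: rational_ext (fun x _ => esym (dlogS (f x) m)) _.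
apply: rationalM; last by apply: rationalV => //; apply: Hf.
apply: rationalB; first by apply: rationalM; [apply: rational_cst | apply: Hf].
apply: rational_sum => j _; apply: rationalM.
  by apply: IH => //; apply: ltn_trans ml.
by apply: Hf; rewrite (leq_trans (leq_subr _ _)) // ltnW.
Qed.

End RationalSeries.

(** * Lattices and characters *)

Section Monomials.
Variable C : fieldType.

(** The Laurent monomial [a ^ c], that is the value at [c] of the character of
    [Z ^ n] that takes the values [a i] on the standard basis. *)
Definition mpow n (a : 'I_n -> C) (c : 'rV[int]_n) : C := \prod_i a i ^ c 0 i.

Lemma mpow_neq0 n (a : 'I_n -> C) c : (forall i, a i != 0) -> mpow a c != 0.
Proof. by move=> a0; apply/prodf_neq0 => i _; apply: expfz_neq0. Qed.

Lemma prod_exprz (I : Type) (r : seq I) (F : I -> C) (c : int) :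
  (\prod_(i <- r) F i) ^ c = \prod_(i <- r) F i ^ c.
Proof.
elim: r => [|i r IH]; first by rewrite !big_nil exp1rz.
by rewrite !big_cons expfzMl IH.
Qed.

Lemma exprz_sum (I : Type) (r : seq I) (F : I -> int) (a : C) : a != 0 ->
  a ^ (\sum_(i <- r) F i) = \prod_(i <- r) a ^ F i.
Proof.
move=> a0; elim: r => [|i r IH]; first by rewrite !big_nil.
by rewrite !big_cons expfzDr // IH.
Qed.

Lemma mpow_mul k n (a : 'I_n -> C) (P : 'M[int]_(k, n)) u :
  (forall i, a i != 0) -> mpow (fun j => mpow a (row j P)) u = mpow a (u *m P).
Proof.
move=> a0; rewrite /mpow.
under eq_bigr do rewrite prod_exprz.
rewrite exchange_big; apply: eq_bigr => i _ /=.
rewrite mxE exprz_sum //; apply: eq_bigr => j _.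
by rewrite mxE exprz_exp mulrC.
Qed.

Lemma mpow_row1 n (a : 'I_n -> C) i : mpow a (row i 1%:M) = a i.
Proof.
rewrite /mpow (bigD1 i) //= !mxE eqxx big1 ?mulr1 // => j ij.
by rewrite !mxE eq_sym (negPf ij).
Qed.

Lemma mpowD n (a : 'I_n -> C) c c' : (forall i, a i != 0) ->
  mpow a (c + c') = mpow a c * mpow a c'.
Proof.
by move=> a0; rewrite /mpow -big_split; apply: eq_bigr => i _; rewrite mxE expfzDr.
Qed.

End Monomials.

Lemma exprz_root (C : numClosedFieldType) (y : C) (c : int) :
  y != 0 -> c != 0 -> exists2 x, x != 0 & x ^ c = y.
Proof.
move=> y0; case: c => c c0.
  have c0' : (0 < c)%N by case: c c0.
  exists (c.-root y); last exact: rootCK.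
  by rewrite rootC_eq0.
exists (c.+1.-root y)^-1; first by rewrite invr_eq0 rootC_eq0.
by rewrite NegzE -exprz_inv invrK; exact: rootCK.
Qed.

Lemma smith_rank n d (L : 'M[int]_n) (R : 'M[int]_d) (D : 'M[int]_(n, d)) :
  L \in unitmx -> R \in unitmx ->
  \rank (map_mx intr (L *m D *m R) : 'M[rat]_(n, d)) =
  \rank (map_mx intr D : 'M[rat]_(n, d)).
Proof.
have Hu m (A : 'M[int]_m) : A \in unitmx -> (map_mx intr A : 'M[rat]_m) \in unitmx.
  by rewrite !unitmxE det_map_mx => /(rmorph_unit (intr : int -> rat)).
move=> /Hu Lu /Hu Ru; rewrite !map_mxM mxrankMfree ?row_free_unit //.
by rewrite (eqmxMfull _ (_ : row_full _)) ?row_full_unit.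
Qed.

(** By the Smith normal form the row lattice of [B] has a basis, given by the rows
    of [G], that is made of multiples of members of a basis of [Z ^ d]. A character
    of that lattice then extends to [Z ^ d], because its values have roots of every
    order. The matrices [A] and [Q] express the rows of [B] and those of [G] in
    terms of each other, so that the corresponding Laurent monomials identify the
    characters of the lattice with a torus of dimension [k]. *)
Lemma lattice_basis (C : numClosedFieldType) n d (B : 'M[int]_(n, d)) k :
  \rank (map_mx intr B : 'M[rat]_(n, d)) = k ->
  exists (A : 'M[int]_(n, k)) (Q : 'M[int]_(k, n)) (G : 'M[int]_(k, d)),
  [/\ B = A *m G, Q *m A = 1%:M
    & forall y : 'I_k -> C, (forall j, y j != 0) ->
      exists2 z : 'I_d -> C, forall j, z j != 0 & forall j, mpow z (row j G) = y j].
Proof.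
have [L Lu [R Ru [dd dds ->]]] := int_Smith_normal_form B.
set D := (X in L *m X).
(* The sequence [dd] of elementary divisors may be longer than the diagonal. As
   each divides the next one, the nonzero ones come first; they number [r]. *)
pose r := minn (index 0 dd) (minn n d).
have rn : (r <= n)%N by rewrite /r minnCA geq_minl.
have rd : (r <= d)%N by rewrite /r minnA geq_minr.
have dd_neq0 i : (i < r)%N -> dd`_i != 0.
  move=> ir; have ii : (i < index 0%R dd)%N by rewrite (leq_trans ir) ?geq_minl.
  by have := @before_find int 0 (pred1 0) dd i ii => /= ->.
have dd_eq0 i : (i < n)%N -> (i < d)%N -> (r <= i)%N -> dd`_i = 0.
  move=> iN iD; rewrite /r geq_min [X in _ || X]leqNgt leq_min iN iD orbF => pi.
  have [si|si] := leqP (size dd) i; first by rewrite nth_default.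
  have p_dd : (index 0%R dd < size dd)%N by apply: leq_ltn_trans si.
  have tr : transitive dvdz by move=> x y z; apply: dvdz_trans.
  have := sorted_leq_nth tr (dvdzz) 0 dds _ _ p_dd si pi.
  by rewrite nth_index -?index_mem //  -[dvdz _ _]/(0 %| _)%Z dvd0z => /eqP.
pose del m : 'rV[int]_m := \row_i (if (i < r)%N then dd`_i else 1).
have DE : D = diag_mx (del n) *m pid_mx r.
  apply/matrixP => i j; rewrite mul_diag_mx !mxE.
  have [ir|ri] := ltnP i r; first by rewrite andbT mulr_natr.
  rewrite andbF mulr0; case: eqP => [ij|]; last by rewrite mulr0n.
  by rewrite dd_eq0 // ij.
have -> : \rank (map_mx intr (L *m D *m R) : 'M[rat]_(n, d)) = r.
  rewrite smith_rank // DE map_mxM map_pid_mx.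
  rewrite (eqmxMfull _ (_ : row_full _)) ?rank_pid_mx // row_full_unit unitmxE.
  rewrite map_diag_mx det_diag unitfE; apply/prodf_neq0 => i _.
  by rewrite !mxE intr_eq0; case: ifP => // /dd_neq0.
move=> <- {k}.
have diagC : diag_mx (del n) *m pid_mx r = pid_mx r *m diag_mx (del r) :> 'M[int]_(n, r).
  apply/matrixP => i j; rewrite mul_diag_mx mul_mx_diag !mxE.
  by case: eqP => [->|]; rewrite ?mul0r ?mulr0 // mulrC.
exists (L *m pid_mx r), (pid_mx r *m invmx L), (diag_mx (del r) *m pid_mx r *m R).
split.
- rewrite DE !mulmxA; congr (_ *m R).
  by rewrite -[L *m pid_mx r *m _]mulmxA -diagC -!mulmxA mul_pid_mx !minnn.
- by rewrite mulmxA mulmxKV // mul_pid_mx minnn (minn_idPr rn) pid_mx_1.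
move=> y y0.
have /choice[z' Hz] : forall j : 'I_r, exists x, x != 0 /\ x ^ dd`_j = y j.
  move=> j; have [x x0 xy] := exprz_root (y0 j) (dd_neq0 j (ltn_ord j)).
  by exists x.
(* The extension is defined on the basis [R] of [Z ^ d], by roots of the given
   values for the members that have a multiple in [G] and by 1 for the others. *)
pose zz (c : 'I_d) := if insub (c : nat) is Some j then z' j else 1.
have zz0 c : zz c != 0.
  by rewrite /zz; case: insub => [j|]; [case: (Hz j) | rewrite oner_eq0].
exists (fun c => mpow zz (row c (invmx R))) => [j|j]; first exact: mpow_neq0.
rewrite mpow_mul // row_mul mulmxK //.
pose jd := widen_ord rd j.
rewrite /mpow (bigD1 jd) //= big1 ?mulr1 => [|c cj].
  by rewrite mxE mul_diag_mx !mxE eqxx ltn_ord mulr1 /zz valK; case: (Hz j).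
rewrite mxE mul_diag_mx !mxE.
have -> : (j == c :> nat) = false; last by rewrite mulr0.
by apply/negP => /eqP jc; case/eqP: cj; apply/val_inj.
Qed.

(** * Bases of minimal weight *)

Section MinimalBases.
Variables (F : fieldType) (n d : nat) (M : 'M[F]_(n, d)) (v : 'I_n -> nat).

Definition free_rows k (i : 'I_k -> 'I_n) : bool := row_free (rowsub i M).
Definition weight_sum k (i : 'I_k -> 'I_n) : nat := \sum_a v (i a).

Definition min_basis k (i : 'I_k -> 'I_n) : Prop :=
  free_rows i /\ forall j : 'I_k -> 'I_n, free_rows j -> (weight_sum i <= weight_sum j)%N.

Lemma row_free_rowsub k m (A : 'M[F]_(k, d)) (f : 'I_m -> 'I_k) :
  injective f -> row_free A -> row_free (rowsub f A).
Proof.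
move=> f_inj /row_freeP[B AB]; apply/row_freeP; exists (colsub f B).
apply/matrixP => a b; have /matrixP/(_ (f a) (f b)) := AB.
rewrite !mxE (inj_eq f_inj) => <-.
by apply: eq_bigr => c _; rewrite !mxE.
Qed.

Lemma row_rowsub_sub k (i : 'I_k -> 'I_n) a : (row (i a) M <= rowsub i M)%MS.
Proof. by have := row_sub a (rowsub i M); rewrite row_rowsub. Qed.

Lemma free_rows_eqmx k (i j : 'I_k -> 'I_n) :
  free_rows i -> (forall a, row (i a) M <= rowsub j M)%MS -> free_rows j.
Proof.
rewrite /free_rows /row_free => /eqP ri H; rewrite eqn_leq rank_leq_row /=.
rewrite -{1}ri; apply: mxrankS; apply/row_subP => a.
by rewrite row_rowsub.
Qed.

Lemma min_basis_exists k : (k <= \rank M)%N -> exists i : 'I_k -> 'I_n, min_basis i.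
Proof.
move=> kr.
have [i0 fi0] : exists i : 'I_k -> 'I_n, free_rows i.
  exists (maxrankfun M \o widen_ord kr); rewrite /free_rows.
  have -> : rowsub (maxrankfun M \o widen_ord kr) M =
      rowsub (widen_ord kr) (rowsub (maxrankfun M) M).
    by apply/matrixP => a b; rewrite !mxE.
  apply: row_free_rowsub; last exact: maxrowsub_free.
  by move=> a b /(congr1 val) /= ab; apply/val_inj.
have ex : exists w, `[< exists2 i : 'I_k -> 'I_n, free_rows i & weight_sum i = w >].
  by exists (weight_sum i0); apply/asboolP; exists i0.
case: (ex_minnP ex) => w /asboolP[i fi iw] wmin; exists i; split=> // j fj.
by rewrite iw; apply: wmin; apply/asboolP; exists j.
Qed.

Lemma free_rows_drop k (i : 'I_k.+1 -> 'I_n) a :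
  free_rows i -> free_rows (i \o lift a).
Proof.
rewrite /free_rows => fi.
have -> : rowsub (i \o lift a) M = rowsub (lift a) (rowsub i M).
  by apply/matrixP => b c; rewrite !mxE.
by apply: row_free_rowsub => //; apply: lift_inj.
Qed.

Lemma weight_sum_drop k (i : 'I_k.+1 -> 'I_n) a :
  weight_sum i = (v (i a) + weight_sum (i \o lift a))%N.
Proof. exact: bigD1_ord. Qed.

Definition cons_fun k (x : 'I_n) (i : 'I_k -> 'I_n) : 'I_k.+1 -> 'I_n :=
  fun a => if unlift ord0 a is Some b then i b else x.

Lemma weight_sum_cons k x (i : 'I_k -> 'I_n) :
  weight_sum (cons_fun x i) = (v x + weight_sum i)%N.
Proof.
rewrite (weight_sum_drop _ ord0) /cons_fun unlift_none; congr (_ + _)%N.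
by apply: eq_bigr => b _ /=; rewrite liftK.
Qed.

Lemma free_rows_cons k x (i : 'I_k -> 'I_n) :
  free_rows i -> ~~ (row x M <= rowsub i M)%MS -> free_rows (cons_fun x i).
Proof.
rewrite /free_rows /row_free => /eqP ri xi; rewrite eqn_leq rank_leq_row /=.
have lt : (rowsub i M < rowsub i M + row x M)%MS.
  rewrite ltmxE addsmxSl /=; apply: contra xi; apply: submx_trans.
  exact: addsmxSr.
apply: (@leq_trans (\rank (rowsub i M + row x M)%MS)).
  by have := rank_ltmx lt; rewrite ri.
apply: mxrankS; rewrite addsmx_sub; apply/andP; split.
  apply/row_subP => a; rewrite row_rowsub.
  have := row_rowsub_sub (cons_fun x i) (lift ord0 a).
  by rewrite /cons_fun liftK.
have := row_rowsub_sub (cons_fun x i) ord0.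
by rewrite /cons_fun unlift_none.
Qed.

(** A row that occurs with a nonzero coefficient [q 0 b] in the expression of
    another row can be recovered from it. *)
Lemma free_rows_exchange k x (i : 'I_k -> 'I_n) (q : 'rV_k) b :
  free_rows i -> row x M = q *m rowsub i M -> q 0 b != 0 ->
  free_rows (fun a => if a == b then x else i a).
Proof.
move=> fi xq qb; set j := (fun a => _).
have sub a : a != b -> (row (i a) M <= rowsub j M)%MS.
  by move=> ab; have := row_rowsub_sub j a; rewrite /j (negPf ab).
apply: (free_rows_eqmx fi) => a; have [->{a}|] := eqVneq a b; last exact: sub.
have : row (i b) M = (q 0 b)^-1 *:
    (row x M - \sum_(a | a != b) q 0 a *: row (i a) M).
  rewrite xq mulmx_sum_row (bigD1 b) //= row_rowsub.
  rewrite (eq_bigr (fun a => q 0 a *: row (i a) M)) => [|a _]; last first.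
    by rewrite row_rowsub.
  by rewrite addrK scalerA mulVf // scale1r.
move=> ->; apply: scalemx_sub; apply: addmx_sub.
  by have := row_rowsub_sub j b; rewrite /j eqxx.
rewrite eqmx_opp; apply: summx_sub => a ab; apply: scalemx_sub; exact: sub.
Qed.

Lemma weight_sum_exchange k x (i : 'I_k -> 'I_n) b :
  (weight_sum (fun a => if a == b then x else i a) + v (i b) =
   weight_sum i + v x)%N.
Proof.
rewrite /weight_sum !(bigD1 (P := xpredT) b) //= eqxx.
rewrite (eq_bigr (fun a => v (i a))) => [|a /negPf -> //].
by rewrite addnC (addnC (v x)) addnA.
Qed.

(** The hypotheses say that going from [k] - 1 to [k] elements increases the
    minimal weight by at most [s], and going from [k] to [k] + 1 by more than [s].
    Dropping a row of the minimal family [i] gives the first conclusion; a row of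
    weight at most [s] outside the span of [i] could be added to it at too low a
    cost, which gives the second one; exchanging a row of [i] for a lighter one
    would contradict minimality, which gives the third one. The last one says
    that [i] is adapted to the filtration of its span by the weights. *)
Lemma min_basis_adapted k (i : 'I_k -> 'I_n) s :
  min_basis i ->
  (forall k' (j : 'I_k' -> 'I_n), k = k'.+1 -> free_rows j ->
    (weight_sum i <= s + weight_sum j)%N) ->
  (forall j : 'I_k.+1 -> 'I_n, free_rows j -> (s + weight_sum i < weight_sum j)%N) ->
  [/\ forall a, (v (i a) <= s)%N,
      forall x, (v x <= s)%N -> (row x M <= rowsub i M)%MS
    & forall x (q : 'rV_k), row x M = q *m rowsub i M ->
        forall b, q 0 b != 0 -> (v (i b) <= v x)%N].
Proof.
move=> [fi imin] lo hi; split.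
- case: k i fi imin lo hi => [|k] i fi imin lo hi a; first by case: a.
  have := lo k _ erefl (free_rows_drop a fi).
  by rewrite (weight_sum_drop i a) leq_add2r.
- move=> x xs; apply/negPn/negP => /(free_rows_cons fi)/hi.
  by rewrite weight_sum_cons ltn_add2r ltnNge xs.
- move=> x q xq b qb.
  have := imin _ (free_rows_exchange fi xq qb).
  by rewrite -(leq_add2r (v (i b))) weight_sum_exchange leq_add2l.
Qed.

End MinimalBases.

(** * Newton polyhedra and minimal bases *)

Lemma enum_val_mono n (I : {set 'I_n}) (a b : 'I_#|I|) :
  (a < b)%N -> (enum_val a < enum_val b)%N.
Proof.
move=> ab; pose x := enum_val a.
have so : sorted (relpre val ltn) (enum I).
  rewrite /enum_mem; apply: sorted_filter; first by move=> y z t; apply: ltn_trans.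
  by rewrite -enumT -sorted_map val_enum_ord iota_ltn_sorted.
have tr : transitive (relpre (val : 'I_n -> nat) ltn).
  by move=> y z t; apply: ltn_trans.
have := @sorted_ltn_nth _ _ tr x _ so a b; rewrite !inE -!cardE !ltn_ord.
by rewrite -!enum_val_nth; apply.
Qed.

Section GeneratorMatrix.
Variables (d n : nat) (e : 'I_n -> 'rV[int]_d).

Definition gen_mx : 'M[int]_(n, d) := \matrix_i e i.
Definition ratgen_mx : 'M[rat]_(n, d) := map_mx intr gen_mx.

Lemma gen_mxE i j : gen_mx i j = e i 0 j. Proof. by rewrite mxE. Qed.

(** The coordinates of the wedge product are the maximal minors of the matrix of
    its factors, and a matrix has full row rank exactly when one of these is
    nonzero. *)
Lemma wedge_free k (i : 'I_k -> 'I_n) :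
  wedge (e \o i) <> 0 <-> free_rows ratgen_mx i.
Proof.
pose A := rowsub i ratgen_mx.
pose mnr (j : {ffun 'I_k -> 'I_d}) := \matrix_(a, b) (e \o i) a 0 (j b).
have mnrE j : map_mx intr (mnr j) = colsub j A.
  by apply/matrixP => a b; rewrite !mxE.
have mnr_unit (j : {ffun 'I_k -> 'I_d}) : (colsub j A \in unitmx) = (\det (mnr j) != 0).
  by rewrite -mnrE unitmxE det_map_mx unitfE intr_eq0.
split=> [w0|fi].
  have [j dj] : exists j, \det (mnr j) != 0.
    apply: contrapT => H; apply: w0; apply/ffunP => j; rewrite !ffunE.
    by apply/eqP/negPn/negP => dj; apply: H; exists j.
  apply/row_freeP; exists (colsub j 1%:M *m invmx (colsub j A)).
  rewrite mulmxA [X in X *m _](_ : _ = colsub j A) ?mulmxV ?mnr_unit //.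
  apply/matrixP => a b; rewrite [LHS]mxE [RHS]mxE (bigD1 (j b)) //= big1.
    by rewrite addr0 !mxE eqxx mulr1.
  by move=> c cj; rewrite !mxE (negPf cj) mulr0.
have ft : row_full A^T by rewrite /row_full mxrank_tr; exact: fi.
have := fullrowsub_unit ft; set f := fullrankfun ft => fu w0.
have : colsub f A \in unitmx.
  by rewrite -unitmx_tr trmx_mxsub.
rewrite mnr_unit; have /ffunP/(_ f) := w0; rewrite !ffunE => ->.
by rewrite eqxx.
Qed.

Variable v : 'I_n -> nat.

(** Listing the members of a free family in increasing order changes neither its
    span nor its weight. *)
Lemma free_rows_sort k (i : 'I_k -> 'I_n) : free_rows ratgen_mx i ->
  exists i' : 'I_k -> 'I_n, [/\ forall a b : 'I_k, (a < b)%N -> (i' a < i' b)%N,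
    free_rows ratgen_mx i' & weight_sum v i' = weight_sum v i].
Proof.
move=> fi; pose I : {set 'I_n} := (i @: [set: 'I_k])%SET.
have i_inj : injective i.
  move=> a b ab; have := row_free_inj fi.
  move=> /(_ 1 (delta_mx 0 a) (delta_mx 0 b)).
  rewrite -!rowE !row_rowsub ab => /(_ erefl)/matrixP/(_ 0 a)/eqP.
  by rewrite !mxE !eqxx /= => H; apply/eqP; move: H; case: (a == b).
have kI : k = #|I| by rewrite card_imset // cardsT card_ord.
pose i' a := enum_val (cast_ord kI a).
have i'i a : exists b, i a = i' b.
  have ia : i a \in I by rewrite imset_f // finset.in_setT.
  exists (cast_ord (esym kI) (enum_rank_in ia (i a))).
  by rewrite /i' cast_ordKV enum_rankK_in.
exists i'; split.
- by move=> a b ab; apply: enum_val_mono.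
- apply: (free_rows_eqmx fi) => a; have [b ->] := i'i a.
  exact: row_rowsub_sub.
- rewrite /weight_sum; transitivity (\sum_(x in I) v x).
    rewrite [RHS]big_enum_val (reindex (cast_ord (esym kI))) /=; last first.
      by exists (cast_ord kI) => x _; rewrite ?cast_ordK ?cast_ordKV.
    by apply: eq_bigr => a _; rewrite /i' cast_ordKV.
  rewrite big_imset /=; last by move=> a b _ _; apply: i_inj.
  by apply: eq_bigl => a; rewrite finset.in_setT.
Qed.

End GeneratorMatrix.

Section ToricSemigroup.
Variables (R : realType) (d n : nat) (L : set 'rV[int]_d) (e : 'I_n -> 'rV[int]_d).
Hypotheses (hL : toric_semigroup R L) (he : minimal_generators L e).

Lemma gen_in i : L (e i).
Proof. by have [_ <- _] := he; apply: sub_gen_smallest; exists i. Qed.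

(** A zero generator could be omitted, against minimality. *)
Lemma gen_neq0 i : e i != 0.
Proof.
apply/eqP => ei0; have [_ gL emin] := he.
pose F : set 'rV[int]_d := [set u | range e u /\ u <> 0].
have FE : F = range e.
  apply: emin; first by move=> u [].
  rewrite -gL; apply/seteqP; split.
    apply: smallest_sub; last by move=> u [ru _]; apply: sub_gen_smallest.
    by split=> [X [[X0 _] _]|u w Hu Hw X HX] //; exact: HX.1.2 (Hu X HX) (Hw X HX).
  apply: smallest_sub.
    by split=> [X [[X0 _] _]|u w Hu Hw X HX] //; exact: HX.1.2 (Hu X HX) (Hw X HX).
  move=> u ru X [[X0 _] FX]; have [->//|/eqP u0] := eqVneq u 0.
  by apply: FX.
by have : range e (e i) by []; rewrite -FE => -[_ /(_ ei0)].
Qed.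

(** The generators of the semigroup generate the lattice, so that the members of
    its standard basis are integral combinations of them. *)
Lemma gen_mx_linv : exists P : 'M[int]_(d, n), P *m gen_mx e = 1%:M.
Proof.
have H u : exists c : 'rV[int]_n, c *m gen_mx e = u.
  have : setT u by []; rewrite -(toric_generates_lattice hL).
  have [_ <- _] := he; move: u; apply: smallest_sub.
    split=> [|u w [c <-] [c' <-]]; first by exists 0; rewrite mul0mx.
    by exists (c - c'); rewrite mulmxBl.
  apply: smallest_sub.
    split=> [|u w [c <-] [c' <-]]; first by exists 0; rewrite mul0mx.
    by exists (c + c'); rewrite mulmxDl.
  move=> _ [i _ <-]; exists (delta_mx 0 i); rewrite -rowE.
  by apply/rowP => j; rewrite mxE gen_mxE.
have /choice[P HP] : forall j, exists c : 'rV[int]_n, c *m gen_mx e = row j 1%:M.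
  by move=> j; apply: H.
exists (\matrix_j P j); apply/row_matrixP => j.
by rewrite row_mul rowK HP.
Qed.

Lemma ratgen_rank : \rank (ratgen_mx e) = d.
Proof.
have [P PE] := gen_mx_linv; apply/eqP; rewrite -/(row_full _).
apply/row_fullP; exists (map_mx intr P).
by rewrite -map_mxM PE map_mx1.
Qed.

Variable nu : 'cV[int]_d.
Hypothesis hnu : interior (cone L) (embN R nu).

Lemma pairing_emb u : pairing (embN R nu) (embM R u) = (pairing nu u)%:~R.
Proof. by rewrite /pairing -map_mxM mxE. Qed.

Lemma dual_cone_emb u : L u -> dual_cone L (embM R u).
Proof.
move=> Lu; exists 1%N, (fun=> 1), (fun=> u); split=> //.
by rewrite big_ord1 scale1r.
Qed.

Lemma pairing_ge0 w : dual_cone L w -> 0 <= pairing (embN R nu) w.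
Proof. by have := @interior_subset _ (cone L) _ hnu; apply. Qed.

(** As [nu] is interior, it stays in the cone after a small positive multiple
    [del] of the transpose of [u] is subtracted, and the pairing of this multiple
    with [u] is positive. *)
Lemma pairing_gt0 u : L u -> u != 0 -> 0 < pairing nu u.
Proof.
move=> Lu u0; rewrite -(ltr0z R) -pairing_emb.
have : nbhs (embN R nu) (cone L) by exact: hnu.
case/nbhs_ballP => eps /= eps0 Hb.
pose S : R := \sum_j `|(embM R u) 0 j|.
have S0 : 0 <= S by apply: sumr_ge0.
have S1 : 0 < 1 + S by rewrite ltr_pwDl.
pose del := eps / (1 + S).
have del0 : 0 < del by rewrite divr_gt0.
have cn : cone L (embN R nu - del *: (embM R u)^T).
  apply: Hb; split=> // i j; rewrite -ball_normE /= ord1 !mxE opprB addrC subrK.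
  rewrite normrM gtr0_norm // /del mulrAC ltr_pdivrMr // ltr_pM2l //.
  apply: (@le_lt_trans _ _ S); last by rewrite ltrDr.
  rewrite /S (bigD1 i) //= mxE lerDl; apply: sumr_ge0 => ? _; exact: normr_ge0.
have := cn _ (dual_cone_emb Lu).
rewrite /pairing mulmxBr mxE -scalemxAr [X in _ + X]mxE [X in - X]mxE subr_ge0.
apply: lt_le_trans; apply: mulr_gt0 => //.
have [j uj] : exists j, u 0 j != 0.
  apply: contrapT => H; case/eqP: u0; apply/rowP => j; rewrite mxE.
  by apply/eqP/negPn/negP => uj; apply: H; exists j.
rewrite mxE (bigD1 j) //=; apply: ltr_pwDl.
  by rewrite !mxE -expr2 exprn_even_gt0 // intr_eq0.
by apply: sumr_ge0 => c _; rewrite !mxE -expr2 sqr_ge0.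
Qed.

Definition gen_weight (i : 'I_n) : nat := `|pairing nu (e i)|%N.

Lemma gen_weightE i : (gen_weight i)%:Z = pairing nu (e i).
Proof. by rewrite /gen_weight gez0_abs // ltW // pairing_gt0 ?gen_neq0 //; apply: gen_in. Qed.

Lemma gen_weight_gt0 i : (0 < gen_weight i)%N.
Proof. by rewrite -ltz_nat gen_weightE pairing_gt0 ?gen_neq0 //; apply: gen_in. Qed.

Lemma pairing_sum k (i : 'I_k -> 'I_n) :
  pairing nu (\sum_a e (i a)) = (weight_sum gen_weight i)%:Z.
Proof.
rewrite /pairing mulmx_suml summxE /weight_sum (big_morph Posz PoszD erefl).
by apply: eq_bigr => a _; rewrite gen_weightE.
Qed.

(** A linear form that is nonnegative on the recession cone of a polyhedron
    reaches its infimum at one of the generating points. For the [k]-th Newton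
    polyhedron these are the sums of [k] independent generators. *)
Lemma ordJ_min_basis k (i : 'I_k -> 'I_n) :
  min_basis (ratgen_mx e) gen_weight i ->
  ordJ L e k (embN R nu) = ((weight_sum gen_weight i)%:R)%:E.
Proof.
move=> [fi imin]; apply/eqP; rewrite eq_le; apply/andP; split.
  have [i' [i'mono fi' wi']] := free_rows_sort gen_weight fi.
  apply: ge_ereal_inf; exists (pairing (embN R nu) (embM R (\sum_a e (i' a))))%:E.
    exists (embM R (\sum_a e (i' a))) => //; apply: sub_gen_smallest.
    exists (\sum_a e (i' a)); first by exists i'; split=> //; apply/wedge_free.
    exists 0; last by rewrite addr0.
    by exists 0%N, (fun=> 0), (fun=> 0); split=> //; [case|rewrite big_ord0].
  by rewrite pairing_emb pairing_sum wi' lee_fin pmulrn lexx.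
apply/ereal_infP => _ [w Hw <-]; rewrite lee_fin; move: w Hw.
apply: smallest_sub.
  move=> x y t; rewrite !inE => /= Hx Hy.
  rewrite /conv /= /pairing mulmxDl -!scalemxAl mxE [X in X + _]mxE [X in _ + X]mxE.
  set W := (weight_sum _ _)%:R.
  have t0 : 0 <= t%:num by [].
  have t1 : 0 <= 1 - t%:num by rewrite subr_ge0.
  rewrite -[W]mul1r -[X in X * W](subrK t%:num 1) mulrDl addrC.
  by apply: lerD; apply: ler_wpM2l.
move=> _ [u Ju [w Hw <-]] /=.
rewrite /pairing mulmxDl mxE -!/(pairing _ _) -[leLHS]addr0.
apply: lerD; last exact: pairing_ge0.
have [j [_ /wedge_free fj ->]] := Ju.
by rewrite pairing_emb pairing_sum -pmulrn ler_nat imin.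
Qed.

End ToricSemigroup.

Section AdaptedBasis.
Variables (R : realType) (d n : nat) (L : set 'rV[int]_d) (e : 'I_n -> 'rV[int]_d).
Hypotheses (hL : toric_semigroup R L) (he : minimal_generators L e).
Variable nu : 'cV[int]_d.
Hypothesis hnu : interior (cone L) (embN R nu).
Local Notation M := (ratgen_mx e).
Local Notation v := (gen_weight e nu).

Lemma phi_min_basis k (i : 'I_k.+1 -> 'I_n) (j : 'I_k -> 'I_n) : (k < d)%N ->
  min_basis M v i -> min_basis M v j ->
  phi L e k.+1 (embN R nu) = ((weight_sum v i)%:R - (weight_sum v j)%:R)%:E.
Proof.
move=> kd bi bj; rewrite /phi /= eqSS (ltn_eqF kd) eqSS.
rewrite !(ordJ_min_basis he hnu bi).
case: k i j kd bi bj => [|k] i j kd bi bj /=.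
  by rewrite (ordJ_min_basis he hnu bi) [weight_sum v j]/weight_sum big_ord0 subr0.
by rewrite (ordJ_min_basis he hnu bj) EFinB.
Qed.

(** The inequalities that define [Aset] compare [s] with the increments of the
    minimal weights of independent families of generators, so that they are the
    hypotheses of [min_basis_adapted]. *)
Lemma adapted_basis k s : (k <= d)%N -> Aset R L e k (nu, s) ->
  exists i : 'I_k -> 'I_n,
  [/\ free_rows M i,
      ordJ L e k (embN R nu) = ((weight_sum v i)%:R)%:E
    & [/\ forall a, (v (i a) <= s)%N,
      forall x, (v x <= s)%N -> (row x M <= rowsub i M)%MS
    & forall x (q : 'rV_k), row x M = q *m rowsub i M ->
        forall b, q 0 b != 0 -> (v (i b) <= v x)%N]].
Proof.
move=> kd [/= _ _ lo hi].
have ex k' : (k' <= d)%N -> exists i : 'I_k' -> 'I_n, min_basis M v i.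
  by move=> kd'; apply: min_basis_exists; rewrite (ratgen_rank hL he).
have [i bi] := ex k kd; exists i; split; [by case: bi | exact: ordJ_min_basis|].
apply: min_basis_adapted => //.
- move=> k' j kE fj; subst k.
  have [j' bj'] := ex k' (ltnW kd).
  move: lo; rewrite (phi_min_basis kd bi bj') lee_fin lerBlDr -natrD ler_nat.
  by move=> /leq_trans; apply; rewrite leq_add2l bj'.2.
- move=> j fj.
  have kd' : (k < d)%N.
    by rewrite -(ratgen_rank hL he) -(eqP fj); apply: mxrankS; apply/row_subP => a;
      rewrite row_rowsub row_sub.
  have [j' bj'] := ex k.+1 kd'.
  move: hi; rewrite (phi_min_basis kd' bj' bi) lte_fin ltrBrDr -natrD ltr_nat.
  by move=> /leq_trans; apply; apply: bj'.2.
Qed.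

End AdaptedBasis.

(** * Toric arcs *)

Section ToricPoints.
Variables (C : fieldType) (d n : nat) (e : 'I_n -> 'rV[int]_d).
Variables (A : comNzRingType) (c : {rmorphism C -> A}).

(** If the monomials in [x] only depend on their weights, then a polynomial takes
    at [x] a value that is a combination of its sums of coefficients by weight,
    and these vanish on the toric ideal. *)
Lemma toric_points_of_weight (x : 'I_n -> A) (H : 'rV[int]_d -> A) :
  (forall m : multinom n, \prod_i x i ^+ m i = H (weight e m)) ->
  toric_points e c x.
Proof.
move=> xH p Hp; rewrite /mmap.
pose us := undup [seq weight e m | m <- msupp p].
transitivity (\sum_(m <- msupp p) \sum_(u <- us | weight e m == u)
    c (mcoeff m p) * H u).
  apply: eq_big_seq => m mp; rewrite /mmap1 xH -big_filter.
  rewrite (eq_filter (a2 := pred1 (weight e m))) => [|u]; last exact: eq_sym.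
  by rewrite filter_pred1_uniq ?undup_uniq ?mem_undup ?map_f // big_seq1.
rewrite (exchange_big_dep xpredT) //= big1 // => u _.
by rewrite -mulr_suml -rmorph_sum Hp rmorph0 mul0r.
Qed.

Lemma binomial_in_ideal (m m' : multinom n) :
  weight e m = weight e m' ->
  toric_ideal e (mpolyX C m - mpolyX C m').
Proof.
move=> mm u; set p := _ - _.
have [mE|mE] := eqVneq m m'.
  by rewrite /p mE subrr msupp0 big_nil.
transitivity (\sum_(k <- [:: m; m'] | weight e k == u) mcoeff k p).
  rewrite [RHS](bigID (mem (msupp p))) /= [X in _ + X]big1 ?addr0; last first.
    by move=> k /andP[_ /memN_msupp_eq0].
  under [RHS]eq_bigl do rewrite andbC.
  rewrite -[RHS]big_filter_cond; apply: perm_big; rewrite perm_sym; apply: uniq_perm.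
  - by rewrite filter_uniq //= inE mE.
  - exact: msupp_uniq.
  - move=> k; rewrite mem_filter; apply: andb_idr => /(msuppB_le (p := mpolyX C m)).
    by rewrite mem_cat !msuppX !inE.
have mE' : m' != m by rewrite eq_sym.
rewrite !big_cons big_nil /p !mcoeffB !mcoeffX !eqxx (negPf mE) (negPf mE').
rewrite mm; case: (_ == u) => //.
by rewrite subr0 sub0r addr0 subrr.
Qed.

Lemma toric_points_weight (x : 'I_n -> A) (m m' : multinom n) :
  toric_points e c x -> weight e m = weight e m' ->
  \prod_i x i ^+ m i = \prod_i x i ^+ m' i.
Proof.
move=> xP /binomial_in_ideal/xP; rewrite mmapB !mmapX => /eqP.
by rewrite subr_eq0 => /eqP.
Qed.

End ToricPoints.

Section ToricArcs.
Variables (C : numFieldType) (d n : nat) (e : 'I_n -> 'rV[int]_d).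
Variables (nu : 'cV[int]_d) (v : 'I_n -> nat).
Hypothesis vE : forall i, (v i)%:Z = pairing nu (e i).

Definition lform (W : 'I_d -> fps C) (u : 'rV[int]_d) : fps C :=
  fun l => \sum_j (u 0 j)%:~R * W j l.

Lemma lformD W u u' : lform W (u + u') = lform W u + lform W u'.
Proof.
apply/funext => l; rewrite fps_addE /lform -big_split; apply: eq_bigr => j _.
by rewrite mxE rmorphD mulrDl.
Qed.

Lemma lform0 W : lform W 0 = 0.
Proof. by apply/funext => l; apply: big1 => j _; rewrite mxE mul0r. Qed.

(** A homomorphism from the lattice to the multiplicative group of Laurent series
    amounts to its order [nu], a character [mpow z] that gives the leading
    coefficients, and an additive map [lform W] that gives the logarithmic
    derivatives. *)
Definition torus_arc z W (i : 'I_n) : fps C :=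
  polar (v i) (mpow z (e i)) (lform W (e i)).

Lemma weight_pairing (m : multinom n) :
  (\sum_i v i * m i)%N%:Z = pairing nu (weight e m).
Proof.
rewrite /pairing /weight mulmx_suml summxE (big_morph Posz PoszD erefl).
apply: eq_bigr => i _; rewrite PoszM vE -natz mulr_natr /pairing.
elim: (m i) => [|k IH]; first by rewrite !mulr0n mul0mx mxE.
by rewrite [in RHS]mulrS mulmxDl [RHS]mxE mulrS IH.
Qed.

Lemma mpow0 (z : 'I_d -> C) : mpow z 0 = 1.
Proof. by apply: big1 => i _; rewrite mxE. Qed.

Lemma torus_arc_prod z W (m : multinom n) : (forall j, z j != 0) ->
  \prod_i torus_arc z W i ^+ m i =
  polar `|pairing nu (weight e m)|%N (mpow z (weight e m)) (lform W (weight e m)).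
Proof.
move=> z0; rewrite -weight_pairing /=.
under eq_bigr do rewrite polarX.
rewrite polar_prod; congr polar.
  rewrite /weight (big_morph _ (fun u u' => mpowD u u' z0) (mpow0 z)).
  apply: eq_bigr => i _; elim: (m i) => [|k IH]; first by rewrite expr0 mulr0n mpow0.
  by rewrite exprS IH mulrS mpowD.
rewrite /weight (big_morph _ (lformD W) (lform0 W)); apply: eq_bigr => i _.
by elim: (m i) => [|k IH]; rewrite ?mulr0n ?lform0 // !mulrS IH lformD.
Qed.

Lemma torus_arc_toric z W : (forall j, z j != 0) ->
  toric_arcs e nu (torus_arc z W).
Proof.
move=> z0; split.
  apply: (@toric_points_of_weight _ _ _ _ _ _ _ (fun u =>
    polar `|pairing nu u|%N (mpow z u) (lform W u))) => m.
  exact: torus_arc_prod.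
move=> m; rewrite torus_arc_prod //.
have [H1 H2] := @polar_ord C `|pairing nu (weight e m)|%N (mpow z (weight e m))
  (lform W (weight e m)) (mpow_neq0 _ z0).
by split=> //; rewrite H2 -weight_pairing.
Qed.

Lemma polar_agree l (a : C) (w w' : fps C) :
  (forall j, w j.+1 = w' j.+1) -> polar l a w = polar l a w'.
Proof.
move=> ww; congr (shift _ _); apply/funext => m.
by apply: (@expser_agree _ _ _ _ m).
Qed.

Variable P : 'M[int]_(d, n).
Hypothesis PE : P *m gen_mx e = 1%:M.

(** An arc that meets the torus sends the semigroup to nonzero series, hence
    extends to a homomorphism from the lattice to the multiplicative group of
    Laurent series. Here [P] expresses the standard basis in terms of the
    generators; the choice is harmless, because the leading coefficients and the
    logarithmic derivatives of the arc respect every integral relation between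
    generators. *)
Lemma toric_arc_torus h : toric_arcs e nu h ->
  exists z W, (forall j, z j != 0) /\ h = torus_arc z W.
Proof.
move=> [hP hord].
have prodU (x : 'I_n -> fps C) i : \prod_j x j ^+ (mnm1 i : multinom n) j = x i.
  rewrite (bigD1 i) //= mnm1E eqxx expr1 big1 ?mulr1 // => j ij.
  by rewrite mnm1E eq_sym (negPf ij).
have hne i : h i != 0 /\ fps_ord (h i) = v i.
  have [] := hord (mnm1 i); rewrite prodU => h0 hv; split=> //.
  apply/eqP; rewrite -eqz_nat hv vE /weight (bigD1 i) //= mnm1E eqxx big1 ?addr0 //.
  by move=> j ij; rewrite mnm1E eq_sym (negPf ij).
have /choice[w hw] : forall i, exists w, h i = polar (v i) (h i (v i)) w.
  by move=> i; have [h0 <-] := hne i; apply: polarP.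
pose a i := h i (v i).
have a0 i : a i != 0 by have [h0 hv] := hne i; have [] := ord_shift h0; rewrite hv.
have hprod (m : multinom n) : \prod_i h i ^+ m i =
    polar (\sum_i v i * m i) (\prod_i a i ^+ m i) (\sum_i w i *+ m i).
  rewrite -polar_prod; apply: eq_bigr => i _.
  by rewrite {1}hw polarX.
have rel (m m' : multinom n) : weight e m = weight e m' ->
    \prod_i a i ^+ m i = \prod_i a i ^+ m' i /\
    forall l, (\sum_i w i *+ m i) l.+1 = (\sum_i w i *+ m' i) l.+1.
  move=> mm; have := toric_points_weight hP mm; rewrite !hprod.
  have -> : (\sum_i v i * m i = \sum_i v i * m' i)%N.
    by apply/eqP; rewrite -eqz_nat !weight_pairing mm.
  by apply: polar_inj; apply/prodf_neq0 => i _; rewrite expf_neq0.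
have sumE (m : multinom n) l :
    (\sum_i w i *+ m i) l = \sum_i w i l *+ m i.
  elim/big_rec2: _ => // i x y _ <-; rewrite fps_addE; congr (_ + _).
  by elim: (m i) => // k IH; rewrite !mulrS fps_addE IH.
(* An integral relation is the difference of two exponents of equal weight. *)
pose pos (c : 'rV[int]_n) : multinom n :=
  Multinom (mktuple (fun i => if (0 <= c 0 i)%R then absz (c 0 i) else 0%N)).
have posE (c : 'rV[int]_n) i : pos c i = if (0 <= c 0 i)%R then absz (c 0 i) else 0%N.
  exact: mnmE.
have posB (c : 'rV[int]_n) i : c 0 i = (pos c i)%:Z - (pos (- c) i)%:Z.
  rewrite !posE mxE oppr_ge0; case: (ltgtP (c 0 i) 0) => [c0|c0|->] //=.
  - by rewrite abszN sub0r ltz0_abs // opprK.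
  - by rewrite subr0 gtz0_abs.
have weightE (m : multinom n) : weight e m = (\row_i (m i)%:Z) *m gen_mx e.
  rewrite mulmx_sum_row /weight; apply: eq_bigr => i _.
  by rewrite rowK mxE -scaler_nat; congr (_ *: _); rewrite natz.
have relc (c : 'rV[int]_n) : c *m gen_mx e = 0 ->
    mpow a c = 1 /\ forall l, \sum_i (c 0 i)%:~R * w i l.+1 = 0.
  move=> cE; have [] := rel (pos c) (pos (- c)).
    apply/eqP; rewrite !weightE -subr_eq0 -mulmxBl -cE; apply/eqP; congr (_ *m _).
    by apply/rowP => i; rewrite [RHS]posB !mxE.
  move=> r1 r2; split.
    have -> : mpow a c = \prod_i (a i ^+ pos c i / a i ^+ pos (- c) i).
      by apply: eq_bigr => i _; rewrite {1}posB expfzDr // -invr_expz.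
    by rewrite prodf_div r1 divff //; apply/prodf_neq0 => i _; rewrite expf_neq0.
  move=> l; have := r2 l; rewrite !sumE => /eqP; rewrite -subr_eq0 -sumrB => /eqP; apply: etrans.
  apply: eq_bigr => i _.
  by rewrite {1}posB intrB mulrBl -!pmulrn !mulr_natl.
pose z j := mpow a (row j P).
pose W j : fps C := fun l => \sum_i (P j i)%:~R * w i l.
exists z, W; split=> [j|]; first exact: mpow_neq0.
apply/funext => i; rewrite hw /torus_arc.
have cE : (e i *m P - row i 1%:M) *m gen_mx e = 0.
  rewrite mulmxBl -mulmxA PE mulmx1 -row_mul mul1mx.
  by apply/rowP => j; rewrite !mxE subrr.
have [r1 r2] := relc _ cE.
have -> : mpow z (e i) = h i (v i).
  rewrite mpow_mul // -[e i *m P](subrK (row i 1%:M)) mpowD // r1 mul1r.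
  by rewrite mpow_row1.
apply: polar_agree => l; rewrite /lform /W.
under [RHS]eq_bigr do rewrite mulr_sumr.
rewrite exchange_big /=; apply/eqP; rewrite eq_sym -subr_eq0; apply/eqP.
apply: etrans (r2 l).
under [RHS]eq_bigr do rewrite !mxE intrB mulrBl.
rewrite sumrB; congr (_ - _).
  apply: eq_bigr => k _; rewrite rmorph_sum mulr_suml; apply: eq_bigr => j _.
  by rewrite rmorphM mulrA.
rewrite (bigD1 i) //= eqxx mul1r big1 ?addr0 // => k ki.
by rewrite eq_sym (negPf ki) mul0r.
Qed.

End ToricArcs.

Section Truncation.
Variables (C : fieldType) (s : nat).
Implicit Types f g : fps C.
Local Notation X := ('X^(s.+1) : {poly C}).

Lemma mk_monic_Xn : mk_monic X = X.
Proof. by rewrite /mk_monic size_polyXn monicXn. Qed.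

Lemma coef_trunc f j : (fps_trunc s f : {poly C})`_j = if (j < s.+1)%N then f j else 0.
Proof.
rewrite /fps_trunc in_qpoly_small ?coef_poly //.
by rewrite mk_monic_Xn size_polyXn ltnS size_poly.
Qed.

Lemma in_qpolyXn : in_qpoly X X = 0.
Proof. by apply: val_inj; rewrite /= mk_monic_Xn Pdiv.RingMonic.rmodpp ?monicXn. Qed.

Lemma fps_truncM f g : fps_trunc s (f * g) = fps_trunc s f * fps_trunc s g.
Proof.
rewrite /fps_trunc -in_qpolyM.
set p := (\poly_(j < s.+1) f j * _).
rewrite -[p in RHS](poly_take_drop s.+1) in_qpolyD in_qpolyM in_qpolyXn mulr0 addr0.
congr (in_qpoly _ _); apply/polyP => j.
rewrite coef_poly coef_take_poly; case: ifP => // js.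
rewrite /p coefM fps_mulE; apply: eq_bigr => i _; rewrite !coef_poly.
by rewrite (leq_ltn_trans (leq_subr _ _) js) (leq_ltn_trans _ js) // -ltnS.
Qed.

Lemma fps_trunc1 : fps_trunc s 1 = 1 :> jet_ring C s.
Proof.
apply: val_inj; apply/polyP => j; rewrite [LHS]coef_trunc /= coef1.
by case: j => [|j] //=; case: ifP.
Qed.

Lemma fps_trunc_prod n (h : 'I_n -> fps C) (m : 'I_n -> nat) :
  fps_trunc s (\prod_i h i ^+ m i) = \prod_i fps_trunc s (h i) ^+ m i.
Proof.
rewrite (big_morph _ fps_truncM fps_trunc1); apply: eq_bigr => i _.
elim: (m i) => [|k IH]; first exact: fps_trunc1.
by rewrite [h i ^+ _]exprS fps_truncM IH [RHS]exprS.
Qed.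

Lemma arc_truncE n (h : 'I_n -> fps C) i (j : 'I_s.+1) :
  arc_trunc s h 0 (mxvec_index i j) = h i j.
Proof. by rewrite /arc_trunc /jet_coords mxvecE mxE coef_trunc ltn_ord. Qed.

End Truncation.

(** As truncation is multiplicative, the monomials in a truncated arc also depend
    only on their weights. *)
Lemma torus_arc_jet (C : numFieldType) (d n : nat) (e : 'I_n -> 'rV[int]_d)
    (nu : 'cV[int]_d) (v : 'I_n -> nat) s z W :
  (forall i, (v i)%:Z = pairing nu (e i)) -> (forall i, (0 < v i)%N) ->
  (forall j, z j != 0) ->
  jet_space0 e (arc_trunc s (torus_arc e v z W) : 'rV[C]_(n * s.+1)).
Proof.
move=> vE v0 z0; exists (fun i => fps_trunc s (torus_arc e v z W i)) => //; split.
  apply: (@toric_points_of_weight _ _ _ _ _ _ _ (fun u =>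
    fps_trunc s (polar `|pairing nu u|%N (mpow z u) (lform W u)))) => m.
  by rewrite -(torus_arc_prod vE) // fps_trunc_prod.
by move=> i; rewrite coef_trunc /torus_arc /polar shiftE v0.
Qed.

(** * Coordinates on the truncated arcs *)

Section JetCoordinates.
Variables (C : numClosedFieldType) (d n : nat) (e : 'I_n -> 'rV[int]_d).
Variables (v : 'I_n -> nat) (s k : nat) (b : 'I_k -> 'I_n).
Local Notation M := (ratgen_mx e).
Hypothesis b_free : free_rows M b.
Hypothesis b_le : forall a, (v (b a) <= s)%N.
Hypothesis b_span : forall x, (v x <= s)%N -> (row x M <= rowsub b M)%MS.
Hypothesis b_adapted : forall x (q : 'rV_k), row x M = q *m rowsub b M ->
  forall a, q 0 a != 0 -> (v (b a) <= v x)%N.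

(** The generators of weight more than [s], which vanish on the jets, are replaced
    by 0 in order to keep the index set ['I_n]. *)
Definition low_mx : 'M[int]_(n, d) := \matrix_x (if (v x <= s)%N then e x else 0).

Lemma low_mx_rank : \rank (map_mx intr low_mx : 'M[rat]_(n, d)) = k.
Proof.
have rowE x : (v x <= s)%N ->
    row x (map_mx intr low_mx : 'M[rat]_(n, d)) = row x M.
  by move=> xs; apply/rowP => j; rewrite !mxE xs.
rewrite -(eqP b_free); apply/eqP; rewrite eqn_leq; apply/andP; split;
  apply: mxrankS; apply/row_subP => x.
  have [xs|xs] := leqP (v x) s; first by rewrite rowE // b_span.
  have -> : row x (map_mx intr low_mx : 'M[rat]_(n, d)) = 0; last exact: sub0mx.
  by apply/rowP => j; rewrite !mxE leqNgt xs mxE.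
by rewrite row_rowsub -rowE // row_sub.
Qed.

Definition coef_mx : 'M[rat]_(n, k) := M *m pinvmx (rowsub b M).

Lemma coef_mx_row x : (v x <= s)%N -> row x M = row x coef_mx *m rowsub b M.
Proof. by move=> xs; rewrite /coef_mx row_mul mulmxKpV // b_span. Qed.

Lemma ratgenE i j : M i j = (e i 0 j)%:~R.
Proof. by rewrite /ratgen_mx mxE gen_mxE. Qed.

Lemma coef_mx_gen x j : (v x <= s)%N ->
  (e x 0 j)%:~R = \sum_a ratr (coef_mx x a) * (e (b a) 0 j)%:~R :> C.
Proof.
move=> xs; have /rowP/(_ j) := coef_mx_row xs; rewrite mxE [RHS]mxE ratgenE.
move=> /(congr1 (ratr : rat -> C)); rewrite ratr_int rmorph_sum => ->.
apply: eq_bigr => a _; rewrite [row _ _ _ _]mxE [rowsub _ _ _ _]mxE ratgenE.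
by rewrite rmorphM /= ratr_int.
Qed.

Lemma coef_mx_basis a a' : coef_mx (b a) a' = (a == a')%:R.
Proof.
have /matrixP/(_ a a') := mulmxVp b_free; rewrite [RHS]mxE => <-.
by rewrite /coef_mx [LHS]mxE [RHS]mxE; apply: eq_bigr => j _; rewrite !mxE.
Qed.

Variables (A : 'M[int]_(n, k)) (Q : 'M[int]_(k, n)) (G : 'M[int]_(k, d)).
Hypotheses (AG : low_mx = A *m G) (QA : Q *m A = 1%:M).
Hypothesis G_ext : forall y : 'I_k -> C, (forall j, y j != 0) ->
  exists2 z : 'I_d -> C, forall j, z j != 0 & forall j, mpow z (row j G) = y j.

Definition jet_dim : nat := \sum_a (s - v (b a)).
Local Notation m := jet_dim.
Local Notation V := (@torus_times_affine C k m).
Implicit Types (y : 'rV[C]_(k + m)) (x : 'rV[C]_(n * s.+1)).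

(** The affine coordinates of [y] are the coefficients of the logarithmic
    derivatives along the members [b a] of the basis, in the degrees from 1 to
    [s - v (b a)]; an [s]-jet does not see the higher ones. *)
Definition dlog_coord y (a : 'I_k) : fps C := fun l =>
  if l is l'.+1 then
    if insub l' is Some l0 then
      y 0 (rshift k (tagnat.rank (Tagged (fun a => 'I_(s - v (b a))) (l0 : 'I_(s - v (b a))))))
    else 0
  else 0.

Definition torus_coord y (j : 'I_k) : C := y 0 (lshift m j).

(** The torus coordinates of [y] are the values of a character on the basis [G] of
    the lattice that is spanned by the rows of [low_mx]. *)
Definition jet_lead y (i : 'I_n) : C := mpow (torus_coord y) (row i A).

Definition jet_dlog y (i : 'I_n) : fps C :=
  fun l => \sum_a ratr (coef_mx i a) * dlog_coord y a l.

Definition jet_of_coords y : 'rV[C]_(n * s.+1) :=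
  mxvec (\matrix_(i < n, l < s.+1) polar (v i) (jet_lead y i) (jet_dlog y i) l).

Definition jet_coef x (i : 'I_n) (l : nat) : C := x 0 (mxvec_index i (inord l)).

(** The value 1 agrees with that of the character on the zero rows of [low_mx]. *)
Definition lead_of_jet x (i : 'I_n) : C :=
  if (v i <= s)%N then jet_coef x i (v i) else 1.

Definition coords_of_jet x : 'rV[C]_(k + m) :=
  row_mx (\row_j mpow (lead_of_jet x) (row j Q))
    (\row_c dlog (fun l => jet_coef x (b (tag (tagnat.sig c)))
                             (v (b (tag (tagnat.sig c))) + l))
              (tagged (tagnat.sig c)).+1).

Definition lead_poly : mpoly (n * s.+1) C :=
  \prod_(i | (v i <= s)%N) mpolyX C (mnm1 (mxvec_index i (inord (v i)))).

Local Notation U := [set x | peval x lead_poly != 0].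

Lemma lead_polyP x : U x <-> forall i, lead_of_jet x i != 0.
Proof.
rewrite /= /lead_poly /peval (big_morph _ (mevalM _) (meval1 _)) /lead_of_jet.
split=> [/prodf_neq0 H i|H].
  by case: ifP => [/H|_]; rewrite ?mevalXU ?oner_eq0.
by apply/prodf_neq0 => i si; have := H i; rewrite si mevalXU.
Qed.

Lemma jet_of_coordsE y i l : (l <= s)%N ->
  jet_coef (jet_of_coords y) i l = polar (v i) (jet_lead y i) (jet_dlog y i) l.
Proof. by move=> ls; rewrite /jet_coef /jet_of_coords mxvecE mxE inordK. Qed.

Lemma jet_of_coords_shift y i l : (v i + l <= s)%N ->
  jet_coef (jet_of_coords y) i (v i + l)%N = expser (jet_lead y i) (jet_dlog y i) l.
Proof.
by move=> ls; rewrite jet_of_coordsE // /polar shiftE ltnNge leq_addr /= addKn.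
Qed.

Lemma jet_lead_char y (z : 'I_d -> C) i : (forall j, z j != 0) ->
  (forall j, mpow z (row j G) = torus_coord y j) ->
  jet_lead y i = mpow z (if (v i <= s)%N then e i else 0).
Proof.
move=> z0 zG; transitivity (mpow (fun j => mpow z (row j G)) (row i A)).
  by rewrite /jet_lead /mpow; apply: eq_bigr => j _; rewrite -zG.
by rewrite mpow_mul // -row_mul -AG rowK.
Qed.

Lemma lead_of_jet_coords y i : V y -> lead_of_jet (jet_of_coords y) i = jet_lead y i.
Proof.
move=> Vy; rewrite /lead_of_jet; case: ifP => si.
  by rewrite -[X in jet_coef _ _ X]addn0 jet_of_coords_shift ?addn0.
have [z z0 zG] := G_ext Vy.
by rewrite (jet_lead_char i z0 zG) si mpow0.
Qed.

Lemma jet_of_coords_in y : V y -> U (jet_of_coords y).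
Proof.
move=> Vy; apply/lead_polyP => i; rewrite lead_of_jet_coords //.
exact: mpow_neq0.
Qed.

Lemma coords_of_jet_in x : U x -> V (coords_of_jet x).
Proof.
move=> /lead_polyP Ux j; rewrite /coords_of_jet row_mxEl mxE.
exact: mpow_neq0.
Qed.

Lemma jet_dlog_basis y a l : jet_dlog y (b a) l = dlog_coord y a l.
Proof.
rewrite /jet_dlog (bigD1 a) //= coef_mx_basis eqxx rmorph1 mul1r big1 ?addr0 //.
by move=> a' aa'; rewrite coef_mx_basis eq_sym (negPf aa') rmorph0 mul0r.
Qed.

(** A jet gives back the torus coordinates as Laurent monomials in its leading
    coefficients, because [Q] inverts [A] on the left, and the affine coordinates
    by taking the logarithmic derivatives of its components along [b]. *)
Lemma jet_of_coordsK y : V y -> coords_of_jet (jet_of_coords y) = y.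
Proof.
move=> Vy; rewrite -[RHS]hsubmxK /coords_of_jet; congr row_mx; apply/rowP => c.
  rewrite !mxE; transitivity (mpow (fun i => mpow (torus_coord y) (row i A)) (row c Q)).
    by apply: eq_bigr => i _; rewrite lead_of_jet_coords.
  by rewrite mpow_mul // -row_mul QA mpow_row1.
rewrite !mxE; case E : (tagnat.sig c) => [a l] /=.
have ls : (v (b a) + l.+1 <= s)%N.
  by rewrite addnS -ltn_subRL ltn_ord.
have lead0 : jet_coef (jet_of_coords y) (b a) (v (b a) + 0) != 0.
  by rewrite jet_of_coords_shift ?addn0 ?b_le //; apply: mpow_neq0.
transitivity (jet_dlog y (b a) l.+1).
  apply: (is_dlog_inj (l := l.+1) (dlogP _)
    (expser_dlog (jet_lead y (b a)) (jet_dlog y (b a)))) => // l' ll'.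
  by rewrite jet_of_coords_shift // (leq_trans _ ls) // leq_add2l.
rewrite jet_dlog_basis /dlog_coord valK; congr (y 0 (rshift k _)).
by rewrite -(tagnat.sigK c) E.
Qed.

Lemma rational_jet_of_coords c : rational_on V (fun y => jet_of_coords y 0 c).
Proof.
case/mxvec_indexP: c => i l.
apply: (@rational_ext _ _ _ (fun y => polar (v i) (jet_lead y i) (jet_dlog y i) l)).
  by move=> y _; rewrite /jet_of_coords mxvecE mxE.
apply: (@rational_ext _ _ _ (fun y => if (l < v i)%N then 0 else
   expser (jet_lead y i) (jet_dlog y i) (l - v i)%N)).
  by move=> y _; rewrite /polar shiftE.
case: (l < v i)%N; first exact: rational_cst.
apply: (@rational_expser _ _ _ _ _ (l - v i)) => //.
  rewrite /jet_lead /mpow; apply: rational_prod => j _; apply: rationalXz.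
    by move=> y Vy; apply: Vy.
  exact: rational_coord.
move=> j _; apply: rational_sum => a _; apply: rationalM; first exact: rational_cst.
rewrite /dlog_coord; case: insub => [l0|]; last exact: rational_cst.
exact: rational_coord.
Qed.

Lemma rational_coords_of_jet c : rational_on U (fun x => coords_of_jet x 0 c).
Proof.
rewrite /coords_of_jet -[c]splitK; case: (fintype.split c) => {}c /=.
  apply: (@rational_ext _ _ _ (fun x => mpow (lead_of_jet x) (row c Q))).
    by move=> x _; rewrite row_mxEl mxE.
  rewrite /mpow; apply: rational_prod => i _; apply: rationalXz.
    by move=> x /lead_polyP.
  rewrite /lead_of_jet; case: (v i <= s)%N; last exact: rational_cst.
  exact: rational_coord.
case E : (tagnat.sig c) => [a l].
apply: (@rational_ext _ _ _ (fun x => dlog (fun l => jet_coef x (b a) (v (b a) + l)) l.+1)).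
  by move=> x _; rewrite row_mxEr mxE E.
apply: (@rational_dlog _ _ _ _ l.+1) => // [x /lead_polyP/(_ (b a))|j _].
  by rewrite /lead_of_jet b_le addn0.
exact: rational_coord.
Qed.

(** Only the members [b a] of the basis with [v (b a) <= v i] contribute to the
    logarithmic derivative along [e i]. Hence its coefficients in degrees at most
    [s - v i], which are those that the [i]-th component of an [s]-jet sees, are
    combinations of coordinates. *)
Lemma arc_trunc_coords z W y : (forall j, z j != 0) ->
  (forall j, mpow z (row j G) = torus_coord y j) ->
  (forall a l, (l < s - v (b a))%N -> lform W (e (b a)) l.+1 = dlog_coord y a l.+1) ->
  arc_trunc s (torus_arc e v z W) = jet_of_coords y.
Proof.
move=> z0 zG WG; apply/rowP => c; case/mxvec_indexP: c => i l.
rewrite arc_truncE /jet_of_coords mxvecE mxE /torus_arc /polar !shiftE.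
case: ltnP => // vl.
have ls : (l <= s)%N by rewrite -ltnS.
have vs : (v i <= s)%N by apply: leq_trans ls.
rewrite (jet_lead_char i z0 zG) vs.
apply: (@expser_agree _ _ _ _ (l - v i)) => // l' ll'.
have rowi := coef_mx_row vs.
have termE a : ratr (coef_mx i a) * dlog_coord y a l'.+1 =
    ratr (coef_mx i a) * lform W (e (b a)) l'.+1.
  have [->|qa] := eqVneq (coef_mx i a) 0; first by rewrite rmorph0 !mul0r.
  rewrite WG //; apply: (leq_trans ll'); apply: leq_sub => //.
  by apply: (b_adapted rowi); rewrite mxE.
rewrite /jet_dlog (eq_bigr _ (fun a _ => termE a)) /lform.
under [RHS]eq_bigr do rewrite mulr_sumr.
rewrite exchange_big; apply: eq_bigr => j _ /=.
rewrite coef_mx_gen // mulr_suml; apply: eq_bigr => a _.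
by rewrite mulrA.
Qed.

(** Every value of the coordinates comes from an arc, as the characters extend
    from the lattice of [G] to the whole lattice, and additive maps with values in
    power series over [C] extend from the independent family [b]. *)
Lemma image_torus_arcs :
  [set arc_trunc s (torus_arc e v zW.1 zW.2) | zW in
    [set zW : ('I_d -> C) * ('I_d -> fps C) | forall j, zW.1 j != 0]] =
  jet_of_coords @` V.
Proof.
apply/seteqP; split=> [_ [[z W] /= z0 <-]|_ [y Vy <-]].
  pose y : 'rV[C]_(k + m) := row_mx (\row_j mpow z (row j G))
    (\row_c lform W (e (b (tag (tagnat.sig c)))) (tagged (tagnat.sig c)).+1).
  have yG j : mpow z (row j G) = torus_coord y j.
    by rewrite /torus_coord /y row_mxEl mxE.
  exists y; first by move=> j; rewrite -/(torus_coord y j) -yG; apply: mpow_neq0.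
  apply/esym/arc_trunc_coords => // a l ls.
  rewrite /dlog_coord insubT /y row_mxEr mxE.
  by rewrite tagnat.rankK.
have [z z0 zG] := G_ext Vy.
pose W j : fps C := fun l => \sum_a ratr (pinvmx (rowsub b M) j a) * dlog_coord y a l.
exists (z, W) => //; apply: arc_trunc_coords => // a l _; rewrite /lform /W.
under eq_bigr do rewrite mulr_sumr.
rewrite exchange_big -jet_dlog_basis; apply: eq_bigr => a' _ /=.
rewrite /coef_mx mxE rmorph_sum mulr_suml; apply: eq_bigr => j _.
by rewrite ratgenE rmorphM /= ratr_int mulrA.
Qed.

Lemma truncated_torus_arcs :
  let J : set 'rV[C]_(n * s.+1) :=
    [set arc_trunc s (torus_arc e v zW.1 zW.2) | zW in
    [set zW : ('I_d -> C) * ('I_d -> fps C) | forall j, zW.1 j != 0]] in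
  [/\ zariski_open U, exists2 F, zariski_closed F & J = U `&` F
    & variety_isomorphic J V].
Proof.
rewrite image_torus_arcs; apply: image_of_section.
- exact: jet_of_coords_in.
- exact: coords_of_jet_in.
- exact: jet_of_coordsK.
- exact: rational_jet_of_coords.
- exact: rational_coords_of_jet.
Qed.

End JetCoordinates.

(** * Truncations of the arcs of order nu *)

Theorem theorem7p1 (R : realType) (d n : nat) (L : set 'rV[int]_d)
    (e : 'I_n -> 'rV[int]_d)
    (hL : toric_semigroup R L) (he : minimal_generators L e)
    (k : nat) (hk : (k <= d)%N) (nu : 'cV[int]_d) (s : nat)
    (hA : Aset R L e k (nu, s)) :
  let J := @arc_trunc R[i] n s @` toric_arcs e nu in
  locally_closed_in (@jet_space0 R[i] d n e s) J
  /\ (k = 0%N -> variety_isomorphic J [set 0 : 'rV[R[i]]_0])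
  /\ ((0 < k)%N -> exists m : nat,
        (m%:R)%:E = ((k * s)%:R%:E - ordJ L e k (embN R nu))%E
        /\ variety_isomorphic J (@torus_times_affine R[i] k m)).
Proof.
have hnu : interior (cone L) (embN R nu) by have [] := hA.
have [b [b_free ordE [b_le b_span b_adapted]]] := adapted_basis hL he hnu hk hA.
pose v := gen_weight e nu.
have vE : forall i, (v i)%:Z = pairing nu (e i) := gen_weightE he hnu.
have v_gt0 : forall i, (0 < v i)%N := gen_weight_gt0 he hnu.
have [P PE] := gen_mx_linv hL he.
have [A [Q [G [AG QA G_ext]]]] :=
  lattice_basis R[i] (low_mx_rank b_free b_le b_span).
have [Uo [F Fc JUF] Jiso] :=
  truncated_torus_arcs b_free b_le b_span b_adapted AG QA G_ext.
set J0 := (X in X = _ `&` F) in JUF Jiso; set U := (X in zariski_open X) in Uo JUF.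
move=> J.
have JE : J = J0.
  apply/seteqP; split=> [_ [h hP <-]|_ [[z W] /= z0 <-]].
    have [z [W [z0 ->]]] := toric_arc_torus vE PE hP.
    by exists (z, W).
  by exists (torus_arc e v z W) => //; apply: torus_arc_toric.
have dimE : (jet_dim v s b + weight_sum v b = k * s)%N.
  rewrite /jet_dim /weight_sum -big_split /=.
  rewrite (eq_bigr (fun=> s)) => [|a _]; last by rewrite subnK.
  by rewrite sum_nat_const card_ord.
split.
  exists U, F; split=> //; rewrite JE -JUF; apply/seteqP; split=> [x Jx|x []//].
  split=> //; case: Jx => -[z W] /= z0 <-.
  exact: torus_arc_jet vE v_gt0 z0.
split=> [k0|_].
  subst k; move: Jiso; rewrite JE.
  have m0 : jet_dim v s b = 0%N by rewrite /jet_dim big_ord0.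
  rewrite m0 [@torus_times_affine _ _ _](_ : _ = [set 0 : 'rV[R[i]]_0]) //.
  by apply/seteqP; split=> [x _|x _ []] //=; apply/rowP => -[].
exists (jet_dim v s b); split; last by rewrite JE.
by rewrite ordE -EFinB -dimE natrD addrK.
Qed.
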